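(* Let $m\ge1$, $A_0,\dots,A_{2m}>0$, $\epsilon\in\{+1,-1\}$, and consider the analytic Lorentzian metric $\widetilde g_\epsilon$ on $\mathbb R_s\times H_{2m+1}$ defined in the context (and its descent to $\mathbb R_s\times\Gamma\backslash H_{2m+1}$ for a discrete subgroup $\Gamma$). The chronology-violating set is exactly $\{s<0\}$. Every point of this set lies on a smooth closed timelike curve in its constant-$s$ slice. These assertions hold on $\mathbb R\times H_{2m+1}$ and on every discrete left quotient. Fix $s<0$ and put $$c(s)=\frac{A_0^2|s|}{H(s)},\quad a_r(s)=F_r(s)A_{2r-1}^2,\quad d_r(s)=F_r(s)A_{2r}^2,\quad B(s)=\max_{1\le r\le m}\frac1{\sqrt{a_r(s)d_r(s)}} .$$ For a curve $\gamma$ in this slice define its horizontal length by $$L_{\mathrm h}(\gamma)=\int\Big[\sum_{r=1}^m\big(a_r(s)\dot x_r^2+d_r(s)\dot y_r^2\big)\Big]^{1/2}\mathrm du .$$ Among smooth closed timelike curves in this slice on the cover, and among such curves on a quotient whose lifts to the cover are closed, the exact infimum of this length is $$L_*(s)=\frac{4\pi}{B(s)\sqrt{c(s)}}=\frac{4\pi\sqrt{H(s)}}{A_0\sqrt{|s|}}\min_r\big(F_r(s)A_{2r-1}A_{2r}\big).$$ Every such timelike curve satisfies $L_{\mathrm h}>L_*(s)$, and every length greater than $L_*(s)$ is attained. At the limiting length $L_*(s)$ there is a smooth closed null curve. In particular, $$L_*(s)=\frac{4\pi}{A_0}\min_r(A_{2r-1}A_{2r})\,|s|^{-1/2}\big(1+O(s^2)\big)\qquad(s\uparrow0).$$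 If the quotient contains a nonzero central lattice element (that is, $\Gamma$ contains a nontrivial central element), its purely central timelike circles have zero horizontal length; hence the unrestricted quotient infimum is zero.
   Context: $H_{2m+1}$ is the Heisenberg group with coordinates $(x_1,y_1,\dots,x_m,y_m,w)$, where left translation by $(p,q,\varrho)\in\mathbb R^m\times\mathbb R^m\times\mathbb R$ is $(x,y,w)\mapsto(x+p,y+q,w+\varrho+p\cdot y)$; discrete subgroups $\Gamma$ act on $\mathbb R_s\times H_{2m+1}$ by left translations fixing $s$. Put $$\kappa_r=\frac{A_0}{A_{2r-1}A_{2r}},\quad F_r(s)=1+\frac{\kappa_r^2}{16}s^2,\quad H(s)=\prod_{r=1}^mF_r(s),\quad \eta=\mathrm dw-\sum_{r=1}^mx_r\,\mathrm dy_r,$$ $$\widetilde g_\epsilon=\epsilon A_0\,\mathrm ds\,\eta+\frac{A_0^2s}{H(s)}\eta^2+\sum_{r=1}^mF_r(s)\big(A_{2r-1}^2\mathrm dx_r^2+A_{2r}^2\mathrm dy_r^2\big),$$ where $\mathrm ds\,\eta=\frac12(\mathrm ds\otimes\eta+\eta\otimes\mathrm ds)$. This is a left-invariant Ricci-flat Lorentzian metric for all $s\in\mathbb R$, time oriented by declaring the timelike field $\partial_s-\frac{\epsilon H(s)}{A_0\sqrt{1+s^2}}\partial_w$ future directed. The chronology-violating set is the set of points lying on some closed timelike curve. In a constant-$s$ slice with $s<0$ the induced metric is $-c\,\eta^2+\sum_r(a_r\mathrm dx_r^2+d_r\mathrm dy_r^2)$. *)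

(* Defs.v *)
(* The real numbers are Stdlib's R, with Coquelicot for derivatives, integrals
   and limits; MathComp is used only for the index type 'I_m and big operators. *)
From mathcomp Require Export all_boot.
From Stdlib Require Export Reals.
From Coquelicot Require Export Coquelicot.

Set Implicit Arguments.
Unset Strict Implicit.
Unset Printing Implicit Defensive.

Open Scope R_scope.

(* Extrema over r = 1..m, with the junk value 0 only when m = 0. *)
Definition max_ord (m : nat) (f : 'I_m -> R) : R :=
  if codom f is x :: l then foldr Rmax x l else 0.

Definition min_ord (m : nat) (f : 'I_m -> R) : R :=
  if codom f is x :: l then foldr Rmin x l else 0.

Record heis (m : nat) := Heis { hx : 'I_m -> R; hy : 'I_m -> R; hw : R }.

Definition heis1 (m : nat) : heis m := Heis (fun=> 0) (fun=> 0) 0.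

Definition heis_mul (m : nat) (g h : heis m) : heis m :=
  Heis (fun r => hx h r + hx g r) (fun r => hy h r + hy g r)
       (hw h + hw g + \big[Rplus/0]_(r < m) (hx g r * hy h r)).

Definition heis_inv (m : nat) (g : heis m) : heis m :=
  Heis (fun r => - hx g r) (fun r => - hy g r)
       (- hw g + \big[Rplus/0]_(r < m) (hx g r * hy g r)).

Definition heis_central (m : nat) (g : heis m) : Prop :=
  forall h, heis_mul g h = heis_mul h g.

Definition heis_near (m : nat) (delta : R) (g h : heis m) : Prop :=
  [/\ forall r, Rabs (hx h r - hx g r) < delta,
      forall r, Rabs (hy h r - hy g r) < delta
    & Rabs (hw h - hw g) < delta].

Record discrete_subgroup (m : nat) (Gam : heis m -> Prop) : Prop := {
  dsg_one : Gam (heis1 m);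
  dsg_mul : forall g h, Gam g -> Gam h -> Gam (heis_mul g h);
  dsg_inv : forall g, Gam g -> Gam (heis_inv g);
  dsg_discrete : forall g, Gam g -> exists2 delta, 0 < delta &
    forall h, Gam h -> heis_near delta g h -> h = g }.

Record point (m : nat) := Point { pt_s : R; pt_h : heis m }.

(* Tangent vectors, by their components along d/ds, d/dx_r, d/dy_r, d/dw. *)
Record tvec (m : nat) :=
  TVec { v_s : R; v_x : 'I_m -> R; v_y : 'I_m -> R; v_w : R }.

Definition tvec0 (m : nat) : tvec m := TVec 0 (fun=> 0) (fun=> 0) 0.

Definition act (m : nat) (g : heis m) (p : point m) : point m :=
  Point (pt_s p) (heis_mul g (pt_h p)).

(* A point of R x (Gam \ H) is an orbit of Gam, as a subset of R x H; the
   quotient map is p |-> orbit Gam p. *)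
Definition orbit (m : nat) (Gam : heis m -> Prop) (p : point m) :
    point m -> Prop :=
  fun q => exists2 g, Gam g & q = act g p.

Definition smooth_at (m : nat) (gam : R -> point m) (u : R) : Prop :=
  forall n : nat,
  [/\ ex_derive_n (fun t => pt_s (gam t)) n u,
      forall r, ex_derive_n (fun t => hx (pt_h (gam t)) r) n u,
      forall r, ex_derive_n (fun t => hy (pt_h (gam t)) r) n u
    & ex_derive_n (fun t => hw (pt_h (gam t))) n u].

Definition velocity (m : nat) (gam : R -> point m) (u : R) : tvec m :=
  TVec (Derive (fun t => pt_s (gam t)) u)
       (fun r => Derive (fun t => hx (pt_h (gam t)) r) u)
       (fun r => Derive (fun t => hy (pt_h (gam t)) r) u)
       (Derive (fun t => hw (pt_h (gam t))) u).

(* The quotient map is a local diffeomorphism onto the quotient manifold, so a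
   curve of orbits is smooth iff it has a smooth lift near each parameter; its
   velocity is represented by the velocity of such a lift. *)
Definition lift_near (m : nat) (Gam : heis m -> Prop) (c : R -> point m -> Prop)
    (gam : R -> point m) (u : R) : Prop :=
  locally u (fun t => smooth_at gam t /\ c t = orbit Gam (gam t)).

Definition lift (m : nat) (Gam : heis m -> Prop) (c : R -> point m -> Prop)
    (gam : R -> point m) : Prop :=
  forall u, smooth_at gam u /\ c u = orbit Gam (gam u).

Definition lifts_closed (m : nat) (Gam : heis m -> Prop)
    (c : R -> point m -> Prop) (T : R) : Prop :=
  (exists gam, lift Gam c gam) /\
  forall gam, lift Gam c gam -> forall u, gam (u + T) = gam u.

Section Metric.

(* The index 1..m of the formulas is the successor of r : 'I_m, hence A_{2r-1} and
   A_{2r} are read at A_odd r and A_even r. *)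
Variables (m : nat) (A : nat -> R).

Definition A_odd (r : 'I_m) : R := A (2 * r).+1.
Definition A_even (r : 'I_m) : R := A (2 * r).+2.

Definition kappa (r : 'I_m) : R := A 0%nat / (A_odd r * A_even r).

Definition Fr (r : 'I_m) (s : R) : R := 1 + (kappa r) ^ 2 / 16 * s ^ 2.

Definition Hprod (s : R) : R := \big[Rmult/1]_(r < m) Fr r s.

Definition eta (p : point m) (v : tvec m) : R :=
  v_w v - \big[Rplus/0]_(r < m) (hx (pt_h p) r * v_y v r).

Definition coef_c (s : R) : R := A 0%nat ^ 2 * Rabs s / Hprod s.
Definition coef_a (r : 'I_m) (s : R) : R := Fr r s * A_odd r ^ 2.
Definition coef_d (r : 'I_m) (s : R) : R := Fr r s * A_even r ^ 2.

Definition Bmax (s : R) : R :=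
  max_ord (fun r : 'I_m => 1 / sqrt (coef_a r s * coef_d r s)).

Definition Lstar (s : R) : R := 4 * PI / (Bmax s * sqrt (coef_c s)).

Definition hspeed (s : R) (v : tvec m) : R :=
  sqrt (\big[Rplus/0]_(r < m)
          (coef_a r s * v_x v r ^ 2 + coef_d r s * v_y v r ^ 2)).

Definition hlength (s : R) (gam : R -> point m) (T : R) : R :=
  RInt (fun u => hspeed s (velocity gam u)) 0 T.

Definition hlength_quot (Gam : heis m -> Prop) (s : R)
    (c : R -> point m -> Prop) (T L : R) : Prop :=
  exists2 f : R -> R,
    forall u, exists2 gam, lift_near Gam c gam u &
                           f u = hspeed s (velocity gam u)
  & is_RInt f 0 T L.

Variable eps : R.

Definition metric (p : point m) (v v' : tvec m) : R :=
  let s := pt_s p in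
  eps * A 0%nat * ((v_s v * eta p v' + eta p v * v_s v') / 2)
  + A 0%nat ^ 2 * s / Hprod s * (eta p v * eta p v')
  + \big[Rplus/0]_(r < m)
      (Fr r s * (A_odd r ^ 2 * (v_x v r * v_x v' r)
                + A_even r ^ 2 * (v_y v r * v_y v' r))).

Definition timelike (p : point m) (v : tvec m) : Prop := metric p v v < 0.

Definition null (p : point m) (v : tvec m) : Prop :=
  v <> tvec0 m /\ metric p v v = 0.

Definition time_field (p : point m) : tvec m :=
  TVec 1 (fun=> 0) (fun=> 0)
       (- (eps * Hprod (pt_s p) / (A 0%nat * sqrt (1 + pt_s p ^ 2)))).

Definition future_timelike (p : point m) (v : tvec m) : Prop :=
  timelike p v /\ metric p (time_field p) v < 0.

(* Closed curves are periodic maps of the line.  A closed timelike curve, in the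
   sense of chronology theory, is piecewise smooth and future directed: at each
   parameter u, its right and left germs are those of smooth future-directed
   timelike curves (gam1, resp. gam2), so that corners are isolated, hence
   finitely many per period. *)
Definition closed_timelike (gam : R -> point m) (T : R) : Prop :=
  [/\ 0 < T, forall u, gam (u + T) = gam u &
  forall u,
    (exists gam1, locally u (fun t => smooth_at gam1 t /\
       (u <= t -> gam t = gam1 t /\
                  future_timelike (gam1 t) (velocity gam1 t)))) /\
    (exists gam2, locally u (fun t => smooth_at gam2 t /\
       (t <= u -> gam t = gam2 t /\
                  future_timelike (gam2 t) (velocity gam2 t))))].

Definition closed_timelike_quot (Gam : heis m -> Prop)
    (c : R -> point m -> Prop) (T : R) : Prop :=
  [/\ 0 < T, forall u, c (u + T) = c u &
  forall u,
    (exists gam1, locally u (fun t => smooth_at gam1 t /\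
       (u <= t -> c t = orbit Gam (gam1 t) /\
                  future_timelike (gam1 t) (velocity gam1 t)))) /\
    (exists gam2, locally u (fun t => smooth_at gam2 t /\
       (t <= u -> c t = orbit Gam (gam2 t) /\
                  future_timelike (gam2 t) (velocity gam2 t))))].

Definition chronology_violating (p : point m) : Prop :=
  exists gam T u, closed_timelike gam T /\ gam u = p.

Definition chronology_violating_quot (Gam : heis m -> Prop)
    (o : point m -> Prop) : Prop :=
  exists c T u, closed_timelike_quot Gam c T /\ c u = o.

(* Smooth closed curves in the slice {s} x H, resp. {s} x (Gam \ H), whose
   velocity has causal character K (timelike or null) for the full metric. *)
Definition slice_loop (K : point m -> tvec m -> Prop) (s : R)
    (gam : R -> point m) (T : R) : Prop :=
  [/\ 0 < T, forall u, gam (u + T) = gam u, forall u, pt_s (gam u) = s &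
      forall u, smooth_at gam u /\ K (gam u) (velocity gam u)].

Definition slice_loop_quot (K : point m -> tvec m -> Prop)
    (Gam : heis m -> Prop) (s : R) (c : R -> point m -> Prop) (T : R) : Prop :=
  [/\ 0 < T, forall u, c (u + T) = c u, forall u p, c u p -> pt_s p = s &
      forall u, exists2 gam, lift_near Gam c gam u & K (gam u) (velocity gam u)].

Definition timelike_hlengths (s L : R) : Prop :=
  exists gam T, slice_loop timelike s gam T /\ hlength s gam T = L.

Definition timelike_hlengths_closed_lifts (Gam : heis m -> Prop) (s L : R) :
    Prop :=
  exists c T, [/\ slice_loop_quot timelike Gam s c T, lifts_closed Gam c T &
                  hlength_quot Gam s c T L].

Definition timelike_hlengths_quot (Gam : heis m -> Prop) (s L : R) : Prop :=
  exists c T, slice_loop_quot timelike Gam s c T /\ hlength_quot Gam s c T L.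

End Metric.

(* Main.v *)
(** At points with [s >= 0] every future-directed timelike vector has positive
    [s]-component, so the maximum of [s] along a closed timelike curve is
    negative.  For [s < 0] the slice contains loops over an ellipse in one
    [(x_r, y_r)]-plane with [eta] constant; they are timelike exactly when the
    horizontal radius exceeds a threshold, which yields all lengths above
    [Lstar] and a null loop at [Lstar].

    For the lower bound, a closed curve has [int eta = - sum_r int x_r dy_r], so
    timelikeness gives [L < sqrt c * |sum_r int x_r dy_r|], and one needs the
    isoperimetric inequality [|sum_r int x_r dy_r| <= B L^2 / (4 PI)].  It
    follows from Wirtinger's inequality in the parameter [int (speed + delta)],
    in which all coordinates have speed at most one although the horizontal
    speed of the curve may vanish.

    On a quotient, two lifts of a curve differ by an element of [Gam] that is
    locally constant by discreteness. *)

From Stdlib Require Import Lra FunctionalExtensionality PropExtensionality ClassicalEpsilon.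
From HB Require Import structures.
Require Import Defs.

Set Implicit Arguments.
Unset Strict Implicit.
Unset Printing Implicit Defensive.

(** No curve is reparametrized: with a positive periodic weight [om] standing for the derivative of
    the new parameter, Wirtinger's inequality compares the integrals of (f - a)^2 om and f'^2 / om.
    It holds with constant one once the total weight is below 2 PI, and this normalization is the
    source of the 4 PI. Fourier series are avoided by taking for a not the mean but the common value
    of f at two points that halve the weight; what remains is a Dirichlet problem on each half, of
    weight below PI, where a tangent solves the associated Riccati equation.

    One weight serves all the planes. Hence their energies add up to the squared horizontal speed,
    the length of the whole curve appears, and the planes enter only through the largest 1 /
    sqrt(a_r d_r). That plane also carries the extremal ellipse, so the bound is sharp; timelike
    loops miss it because timelikeness is strict pointwise. *)

HB.instance Definition _ := Monoid.isComLaw.Build R 0 Rplus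
  (fun x y z => esym (Rplus_assoc x y z)) Rplus_comm Rplus_0_l.

(** * Real sums, continuity and integrals *)

Lemma sumR_ge0 (I : finType) (f : I -> R) :
  (forall i, 0 <= f i) -> 0 <= \big[Rplus/0]_(i : I) f i.
Proof. by move=> f0; apply: big_ind => // *; lra. Qed.

Lemma sumR_le (I : finType) (f g : I -> R) :
  (forall i, f i <= g i) ->
  \big[Rplus/0]_(i : I) f i <= \big[Rplus/0]_(i : I) g i.
Proof. by move=> fg; apply: big_ind2 => // *; lra. Qed.

Lemma sumR_scal (I : finType) (k : R) (f : I -> R) :
  k * \big[Rplus/0]_(i : I) f i = \big[Rplus/0]_(i : I) (k * f i).
Proof. by apply: big_morph => [x y|]; ring. Qed.

Lemma Rabs_sumR_le (I : finType) (f : I -> R) :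
  Rabs (\big[Rplus/0]_(i : I) f i) <= \big[Rplus/0]_(i : I) Rabs (f i).
Proof.
apply: (big_ind2 (fun x y => Rabs x <= y)) => [|x1 x2 y1 y2 h1 h2|i _].
- by rewrite Rabs_R0; lra.
- by have := Rabs_triang x1 y1; lra.
- by lra.
Qed.

Lemma sumR_delta (I : finType) (i0 : I) (f : I -> R) :
  (forall i, i != i0 -> f i = 0) -> \big[Rplus/0]_(i : I) f i = f i0.
Proof. by move=> f0; rewrite (bigD1 i0) //= big1 //; lra. Qed.

Lemma continuous_extR (f g : R -> R) t : (forall u, f u = g u) ->
  continuous f t -> continuous g t.
Proof. exact: continuous_ext. Qed.

Lemma is_derive_extR (f g : R -> R) t (l : R) : (forall u, f u = g u) ->
  is_derive f t l -> is_derive g t l.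
Proof. exact: is_derive_ext. Qed.

Lemma continuous_add (f g : R -> R) t : continuous f t -> continuous g t ->
  continuous (fun u => f u + g u) t.
Proof. exact: continuous_plus. Qed.

Lemma continuous_sub (f g : R -> R) t : continuous f t -> continuous g t ->
  continuous (fun u => f u - g u) t.
Proof. exact: continuous_minus. Qed.

Lemma continuous_neg (f : R -> R) t : continuous f t ->
  continuous (fun u => - f u) t.
Proof. exact: continuous_opp. Qed.

Lemma continuous_mul (f g : R -> R) t : continuous f t -> continuous g t ->
  continuous (fun u => f u * g u) t.
Proof. exact: continuous_mult. Qed.

Lemma continuous_sq (f : R -> R) t : continuous f t ->
  continuous (fun u => f u ^ 2) t.
Proof.
move=> cf; apply: (@continuous_extR (fun u => f u * f u)); first by move=> u; ring.
exact: continuous_mul.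
Qed.

Lemma continuous_quot (f g : R -> R) t : continuous f t -> continuous g t ->
  g t <> 0 -> continuous (fun u => f u / g u) t.
Proof.
by move=> cf cg g0; apply: continuous_mul => //; apply: continuous_Rinv_comp.
Qed.

Lemma continuous_sumR (I : finType) (f : I -> R -> R) t :
  (forall i, continuous (f i) t) ->
  continuous (fun u => \big[Rplus/0]_(i : I) f i u) t.
Proof.
move=> cf; elim: (index_enum I) => [|i s IH].
  apply: (@continuous_extR (fun=> 0)) => [u|]; first by rewrite big_nil.
  exact: continuous_const.
apply: (@continuous_extR (fun u => f i u + \big[Rplus/0]_(j <- s) f j u)) => [u|].
  by rewrite big_cons.
exact: continuous_add.
Qed.

Lemma is_derive_sumR (I : finType) (f : I -> R -> R) (df : I -> R) t :
  (forall i, is_derive (f i) t (df i)) ->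
  is_derive (fun u => \big[Rplus/0]_(i : I) f i u) t (\big[Rplus/0]_(i : I) df i).
Proof.
move=> cf; elim: (index_enum I) => [|i s IH].
  apply: (@is_derive_extR (fun=> 0)) => [u|]; first by rewrite big_nil.
  by rewrite big_nil; exact: is_derive_const.
apply: (@is_derive_extR (fun u => f i u + \big[Rplus/0]_(j <- s) f j u)) => [u|].
  by rewrite big_cons.
rewrite big_cons; exact: (is_derive_plus (f i)).
Qed.

Lemma ex_RInt_cont (f : R -> R) a b : (forall t, continuous f t) -> ex_RInt f a b.
Proof. by move=> cf; apply: ex_RInt_continuous => z _. Qed.

Lemma RInt_extR (f g : R -> R) a b : (forall t, f t = g t) ->
  RInt f a b = RInt g a b.
Proof. by move=> fg; apply: RInt_ext => t _. Qed.

Lemma RInt_add (f g : R -> R) a b :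
  (forall t, continuous f t) -> (forall t, continuous g t) ->
  RInt (fun t => f t + g t) a b = RInt f a b + RInt g a b.
Proof. by move=> cf cg; apply: RInt_plus; exact: ex_RInt_cont. Qed.

Lemma RInt_scale (f : R -> R) k a b : (forall t, continuous f t) ->
  RInt (fun t => k * f t) a b = k * RInt f a b.
Proof. by move=> cf; apply: RInt_scal; exact: ex_RInt_cont. Qed.

Lemma RInt_sumR (I : finType) (f : I -> R -> R) a b :
  (forall i t, continuous (f i) t) ->
  RInt (fun t => \big[Rplus/0]_(i : I) f i t) a b
  = \big[Rplus/0]_(i : I) RInt (f i) a b.
Proof.
move=> cf; suff [] : (forall t, continuous (fun t => \big[Rplus/0]_(i : I) f i t) t)
    /\ RInt (fun t => \big[Rplus/0]_(i : I) f i t) a b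
       = \big[Rplus/0]_(i : I) RInt (f i) a b by [].
elim: (index_enum I) => [|i s [cs IH]].
  split=> [t|].
    apply: (@continuous_extR (fun=> 0)) => [u|]; first by rewrite big_nil.
    exact: continuous_const.
  rewrite (RInt_ext _ (fun=> 0)) => [|u _]; last by rewrite big_nil.
  by rewrite big_nil RInt_const /scal /= /mult /=; ring.
have ext u : \big[Rplus/0]_(j <- i :: s) f j u
             = f i u + \big[Rplus/0]_(j <- s) f j u by rewrite big_cons.
split=> [t|].
  apply: (continuous_extR (fun u => esym (ext u))); exact: continuous_add.
by rewrite (RInt_ext _ _ _ _ (fun u _ => ext u)) RInt_add // IH big_cons.
Qed.

Lemma RInt_leR (f g : R -> R) a b : a <= b ->
  (forall t, continuous f t) -> (forall t, continuous g t) ->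
  (forall t, f t <= g t) -> RInt f a b <= RInt g a b.
Proof. by move=> ab cf cg fg; apply: RInt_le => // ; exact: ex_RInt_cont. Qed.

Lemma RInt_shift_period (f : R -> R) (T p : R) :
  (forall t, continuous f t) -> (forall t, f (t + T) = f t) ->
  RInt f p (p + T) = RInt f 0 T.
Proof.
move=> cf perf.
have C a b c : RInt f a b + RInt f b c = RInt f a c.
  by apply: RInt_Chasles; exact: ex_RInt_cont.
have E : RInt f T (p + T) = RInt f 0 p.
  have := @RInt_comp_lin R_CompleteNormedModule f 1 T 0 p.
  rewrite !Rmult_1_l Rplus_0_l => <-; last exact: ex_RInt_cont.
  by apply: RInt_ext => t _; rewrite /scal /= /mult /= !Rmult_1_l perf.
by have := C 0 T (p + T); have := C 0 p (p + T); lra.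
Qed.

Definition C1 (f : R -> R) := forall t, ex_derive f t /\ continuous (Derive f) t.

Lemma C1_continuous f t : C1 f -> continuous f t.
Proof. by move=> /(_ t)[df _]; exact: ex_derive_continuous. Qed.

Lemma Derive_periodic (f : R -> R) T t : C1 f -> (forall u, f (u + T) = f u) ->
  Derive f (t + T) = Derive f t.
Proof.
move=> c1 per; rewrite -(Derive_ext _ _ t per).
symmetry; apply: is_derive_unique.
have := is_derive_comp f (fun u => u + T) t (Derive f (t + T)) 1.
rewrite /scal /= /mult /= Rmult_1_l; apply; first exact: (Derive_correct _ _ (proj1 (c1 _))).
by auto_derive.
Qed.

Lemma RInt_DeriveR (f : R -> R) a b : C1 f -> RInt (Derive f) a b = f b - f a.
Proof.
move=> c1; apply: is_RInt_unique.
apply: (is_RInt_derive f) => t _; last by have [] := c1 t.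
exact: (Derive_correct _ _ (proj1 (c1 t))).
Qed.

(** * The isoperimetric inequality *)

Lemma RInt_upper_derive (om : R -> R) p t : (forall u, continuous om u) ->
  is_derive (fun u => RInt om p u) t (om t).
Proof.
move=> co; apply: (is_derive_RInt om _ p) => //.
by apply: filter_forall => u; apply: RInt_correct; exact: ex_RInt_cont.
Qed.

(** Quasi-periodicity makes [Th] unbounded in both directions, so the intermediate value theorem
    gives preimages; strict monotonicity makes them unique and their choice continuous. Applied to
    the accumulated weight, this gives points at prescribed weight. *)
Lemma increasing_inverse (Th : R -> R) (T W : R) :
  (forall t, continuous Th t) -> (forall s t, s < t -> Th s < Th t) ->
  0 < T -> 0 < W -> (forall t, Th (t + T) = Th t + W) ->
  exists2 G : R -> R, (forall t, continuous G t) & forall y, Th (G y) = y.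
Proof.
move=> cTh incr T0 W0 qper.
have qperN n t : Th (t + INR n * T) = Th t + INR n * W.
  elim: n => [|n IH]; first by rewrite /= !Rmult_0_l !Rplus_0_r.
  rewrite S_INR -[RHS]/(_ + (INR n + 1) * W).
  have -> : t + (INR n + 1) * T = t + INR n * T + T by ring.
  by rewrite qper IH; ring.
have ctn : continuity Th by move=> t; apply/continuity_pt_filterlim; exact: cTh.
have surj y : {t | Th t = y}.
  apply: constructive_indefinite_description.
  have [n hn] := INR_unbounded (Rabs (y - Th 0) / W).
  have hnW : Rabs (y - Th 0) < INR n * W.
    by move: hn => /(Rmult_gt_compat_r W _ _ W0); rewrite /Rdiv Rmult_assoc Rinv_l; lra.
  have [h1 h2] := Rabs_def2 _ _ hnW.
  have lo : Th (- (INR n * T)) = Th 0 - INR n * W.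
    have := qperN n (- (INR n * T)).
    have -> : - (INR n * T) + INR n * T = 0 by ring.
    by lra.
  have hi : Th (INR n * T) = Th 0 + INR n * W.
    by have := qperN n 0; rewrite Rplus_0_l.
  have [|t [_ ty]] := @IVT_gen Th (- (INR n * T)) (INR n * T) y ctn; last by exists t.
  by rewrite lo hi Rmin_left ?Rmax_right; lra.
exists (fun y => sval (surj y)) => y; last by case: (surj y).
have GK z : Th (sval (surj z)) = z by case: (surj z).
set G := fun y => sval (surj y).
have ltG z t : z < Th t -> G z < t.
  move=> zt; case: (Rlt_le_dec (G z) t) => // /Rle_lt_or_eq_dec [/incr|tz].
    by rewrite GK; lra.
  by move: zt; rewrite tz GK; lra.
have gtG z t : Th t < z -> t < G z.
  move=> zt; case: (Rlt_le_dec t (G z)) => // /Rle_lt_or_eq_dec [/incr|tz].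
    by rewrite GK; lra.
  by move: zt; rewrite -tz GK; lra.
apply/filterlim_locally => e; have e0 := cond_pos e.
have i1 : Th (G y - e) < y by rewrite -{2}(GK y); apply: incr; rewrite -/(G y); lra.
have i2 : y < Th (G y + e) by rewrite -{1}(GK y); apply: incr; rewrite -/(G y); lra.
have d0 : 0 < Rmin (y - Th (G y - e)) (Th (G y + e) - y) by apply: Rmin_pos; lra.
exists (mkposreal _ d0) => z /Rabs_def2 /=; rewrite /minus /plus /opp /= => -[z1 z2].
have m1 := Rmin_l (y - Th (G y - e)) (Th (G y + e) - y).
have m2 := Rmin_r (y - Th (G y - e)) (Th (G y + e) - y).
apply: Rabs_def1; rewrite /minus /plus /opp /=.
  suff : G z < G y + e by rewrite /G; lra.
  by apply: ltG; lra.
suff : G y - e < G z by rewrite /G; lra.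
by apply: gtG; lra.
Qed.

(** * Weighted Wirtinger inequalities *)

Section Wirtinger.

Variables (f om : R -> R).
Hypotheses (c1f : C1 f) (co : forall t, continuous om t) (om0 : forall t, 0 < om t).

Let quot_cont (g : R -> R) t : continuous g t -> continuous (fun u => g u / om u) t.
Proof. by move=> cg; apply: continuous_quot => //; have := om0 t; lra. Qed.

Let sqom_cont a t : continuous (fun u => (f u - a) ^ 2 * om u) t.
Proof.
apply: continuous_mul => //; apply: continuous_sq; apply: continuous_sub.
  exact: C1_continuous.
exact: continuous_const.
Qed.

Let dsq_cont t : continuous (fun u => Derive f u ^ 2 / om u) t.
Proof. by apply: quot_cont; apply: continuous_sq; have [] := c1f t. Qed.

(* With th the weight measured from the midpoint, the integrand difference is a
   square plus the total derivative of -(f - a)^2 tan th. *)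
Lemma wirtinger_interval (p q a : R) : p <= q -> RInt om p q < PI ->
  f p = a -> f q = a ->
  RInt (fun t => (f t - a) ^ 2 * om t) p q <= RInt (fun t => Derive f t ^ 2 / om t) p q.
Proof.
move=> pq Wpi fp fq; set W := RInt om p q.
pose th t := RInt om p t - W / 2.
pose dpsi t := - (2 * (f t - a) * Derive f t * tan (th t)
                  + (f t - a) ^ 2 * ((tan (th t) ^ 2 + 1) * om t)).
have C b c d : RInt om b c + RInt om c d = RInt om b d.
  by apply: RInt_Chasles; exact: ex_RInt_cont.
have dth t : is_derive th t (om t).
  have -> : om t = om t - 0 by ring.
  apply: (is_derive_minus (fun u => RInt om p u) (fun=> W / 2)).
    exact: RInt_upper_derive.
  exact: is_derive_const.
have ge0 b c : b <= c -> 0 <= RInt om b c.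
  move=> bc; apply: RInt_ge_0 => // [|t _]; [exact: ex_RInt_cont|by have := om0 t; lra].
(* On the interval [th] runs from [- W / 2] to [W / 2], and [W < PI] keeps it strictly inside the
   branch of the tangent. *)
have cos_th t : p <= t <= q -> cos (th t) <> 0.
  move=> [pt tq]; apply/not_eq_sym/Rlt_not_eq/cos_gt_0; rewrite /th.
    by have := ge0 p t pt; rewrite /W in Wpi *; lra.
  by have := ge0 t q tq; have := C p t q; rewrite -/W in Wpi *; lra.
have dtan t : p <= t <= q ->
    is_derive (fun u => tan (th u)) t ((tan (th t) ^ 2 + 1) * om t).
  move=> pt; rewrite Rmult_comm.
  exact: (is_derive_comp tan th t _ _ (is_derive_tan _ (cos_th t pt)) (dth t)).
have ctan t : p <= t <= q -> continuous (fun u => tan (th u)) t.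
  by move=> pt; apply: ex_derive_continuous; exists ((tan (th t) ^ 2 + 1) * om t); exact: dtan.
have cf t : continuous (fun u => f u - a) t.
  by apply: continuous_sub; [exact: C1_continuous|exact: continuous_const].
have I0 : is_RInt dpsi p q 0.
  have -> : 0 = minus (- ((f q - a) ^ 2 * tan (th q))) (- ((f p - a) ^ 2 * tan (th p))).
    by rewrite fp fq /minus /plus /opp /=; ring.
  apply: (is_RInt_derive (fun t => - ((f t - a) ^ 2 * tan (th t)))) => t;
    rewrite (Rmin_left _ _ pq) (Rmax_right _ _ pq) => pt.
    have d1 : is_derive (fun u => (f u - a) ^ 2) t (2 * (f t - a) * Derive f t).
      have df := proj1 (c1f t).
      by auto_derive => //; rewrite (Derive_ext (fun x : R => f x) f) //; ring.
    apply: (is_derive_opp (fun u : R => (f u - a) ^ 2 * tan (th u)) t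
             (2 * (f t - a) * Derive f t * tan (th t)
              + (f t - a) ^ 2 * ((tan (th t) ^ 2 + 1) * om t))).
    apply: (is_derive_mult (fun u => (f u - a) ^ 2) (fun u => tan (th u))) => //.
      exact: dtan.
    exact: Rmult_comm.
  apply: continuous_neg; apply: continuous_add; apply: continuous_mul.
  - apply: continuous_mul; last by have [] := c1f t.
    by apply: continuous_mul => //; exact: continuous_const.
  - exact: ctan.
  - exact: continuous_sq.
  - apply: continuous_mul => //; apply: continuous_add; last exact: continuous_const.
    by apply: continuous_sq; exact: ctan.
have e1 : ex_RInt (fun t => (f t - a) ^ 2 * om t) p q by exact: ex_RInt_cont.
have e2 : ex_RInt (fun t => Derive f t ^ 2 / om t) p q by exact: ex_RInt_cont.
have := RInt_plus _ _ p q (ex_intro _ 0 I0) e1.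
rewrite (is_RInt_unique _ _ _ _ I0) /plus /= Rplus_0_l => <-.
apply: RInt_le => //; first by apply: ex_RInt_plus => //; exists 0.
move=> t _; rewrite /dpsi; set g := f t - a; set D := Derive f t; set k := tan _.
have o := om0 t.
suff : 0 <= D ^ 2 / om t - (- (2 * g * D * k + g ^ 2 * ((k ^ 2 + 1) * om t))
                           + g ^ 2 * om t) by lra.
have -> : D ^ 2 / om t - (- (2 * g * D * k + g ^ 2 * ((k ^ 2 + 1) * om t))
   + g ^ 2 * om t) = (D / om t + g * k) ^ 2 * om t by field; lra.
by apply: Rmult_le_pos; [exact: pow2_ge_0|lra].
Qed.

(* The weight splits a period into two halves whose endpoints share the same
   value of f; each half satisfies the Dirichlet inequality. *)
Lemma wirtinger_periodic (T : R) : 0 < T ->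
  (forall t, f (t + T) = f t) -> (forall t, om (t + T) = om t) ->
  RInt om 0 T < 2 * PI ->
  exists a, RInt (fun t => (f t - a) ^ 2 * om t) 0 T
            <= RInt (fun t => Derive f t ^ 2 / om t) 0 T.
Proof.
move=> T0 perf pero Wpi; set W := RInt om 0 T in Wpi *.
pose Th t := RInt om 0 t.
have C b c d : RInt om b c + RInt om c d = RInt om b d.
  by apply: RInt_Chasles; exact: ex_RInt_cont.
have gt0 b c : b < c -> 0 < RInt om b c.
  by move=> bc; apply: RInt_gt_0.
have incr s t : s < t -> Th s < Th t.
  by move=> st; have := gt0 s t st; have := C 0 s t; rewrite /Th; lra.
have qper t : Th (t + T) = Th t + W.
  by rewrite /Th -(C 0 t (t + T)) RInt_shift_period.
have cTh t : continuous Th t.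
  by apply: ex_derive_continuous; exists (om t); exact: RInt_upper_derive.
have W0 : 0 < W by exact: gt0.
have [G cG GK] := increasing_inverse cTh incr T0 W0 qper.
have ThI s t : Th s = Th t -> s = t.
  by move=> st; case: (Rtotal_order s t) => [/incr|[//|/incr]]; lra.
have GW y : G (y + W) = G y + T by apply: ThI; rewrite qper !GK.
(* By periodicity [k (W / 2) = - k 0], so [k] has a zero: two points half the weight apart where [f]
   agrees. *)
pose k y := f (G (y + W / 2)) - f (G y).
have ck : continuity k.
  move=> y; apply/continuity_pt_filterlim.
  apply: (continuous_sub (f := fun y => f (G (y + W / 2)))).
    apply: (continuous_comp (fun y => G (y + W / 2)) f); last exact: C1_continuous.
    apply: (continuous_comp (fun y => y + W / 2) G) => //.
    by apply: continuous_add; [exact: continuous_id|exact: continuous_const].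
  by apply: (continuous_comp G f) => //; exact: C1_continuous.
have [||y [_ ky]] := IVT_cor k 0 (W / 2) ck.
- by lra.
- rewrite /k; have -> : W / 2 + W / 2 = 0 + W by field.
  rewrite GW perf Rplus_0_l.
  have := pow2_ge_0 (f (G (W / 2)) - f (G 0)); lra.
have fpq : f (G (y + W / 2)) = f (G y) by rewrite /k in ky; lra.
pose p := G y; pose q := G (y + W / 2).
have pT : p + T = G (y + W) by rewrite GW.
have mono z1 z2 : z1 < z2 -> G z1 < G z2.
  move=> z12; case: (Rlt_le_dec (G z1) (G z2)) => // /Rle_lt_or_eq_dec [/incr|/(f_equal Th)];
  rewrite !GK; lra.
have pq : p < q by apply: mono; lra.
have qp : q < p + T by rewrite pT; apply: mono; lra.
have ThB a b : RInt om a b = Th b - Th a by have := C 0 a b; rewrite /Th; lra.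
exists (f p).
have B1 : RInt (fun t => (f t - f p) ^ 2 * om t) p q
          <= RInt (fun t => Derive f t ^ 2 / om t) p q.
  by apply: wirtinger_interval => //; [lra|rewrite ThB /p /q !GK; lra].
have B2 : RInt (fun t => (f t - f p) ^ 2 * om t) q (p + T)
          <= RInt (fun t => Derive f t ^ 2 / om t) q (p + T).
  by apply: wirtinger_interval => //; [lra|rewrite ThB pT /q !GK; lra].
rewrite -(@RInt_shift_period (fun t => (f t - f p) ^ 2 * om t) T p) //;
  last by move=> t; rewrite perf pero.
rewrite -(@RInt_shift_period (fun t => Derive f t ^ 2 / om t) T p) //;
  last by move=> t; rewrite Derive_periodic // pero.
have CC (g : R -> R) : (forall t, continuous g t) ->
    RInt g p q + RInt g q (p + T) = RInt g p (p + T).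
  by move=> cg; apply: RInt_Chasles; exact: ex_RInt_cont.
rewrite -!CC //; lra.
Qed.

End Wirtinger.

(* Wirtinger applied to one coordinate, combined with the AM-GM inequality. *)
Lemma plane_area_bound (x y om : R -> R) (a d T : R) : 0 < a -> 0 < d -> 0 < T ->
  C1 x -> C1 y -> (forall t, continuous om t) -> (forall t, 0 < om t) ->
  (forall t, x (t + T) = x t) -> (forall t, y (t + T) = y t) ->
  (forall t, om (t + T) = om t) -> RInt om 0 T < 2 * PI ->
  Rabs (RInt (fun t => x t * Derive y t) 0 T)
  <= 1 / sqrt (a * d) * (1 / 2
     * RInt (fun t => (a * Derive x t ^ 2 + d * Derive y t ^ 2) / om t) 0 T).
Proof.
move=> a0 d0 T0 cx cy co om0 px py po W.
have [x0 wx] := wirtinger_periodic cx co om0 T0 px po W.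
set k := sqrt (a * d).
have ad0 : 0 < a * d by nra.
have k0 : 0 < k by exact: sqrt_lt_R0.
have kk : k ^ 2 = a * d by rewrite /k pow2_sqrt; lra.
have cDx t : continuous (Derive x) t by have [] := cx t.
have cDy t : continuous (Derive y) t by have [] := cy t.
have cxx t : continuous (fun t => x t - x0) t.
  by apply: continuous_sub; [exact: C1_continuous|exact: continuous_const].
have cxy t : continuous (fun t => (x t - x0) * Derive y t) t by exact: continuous_mul.
have om_neq0 t : om t <> 0 by have := om0 t; lra.
have cS t : continuous (fun t => (x t - x0) ^ 2 * om t) t.
  by apply: continuous_mul => //; exact: continuous_sq.
have cX t : continuous (fun t => Derive x t ^ 2 / om t) t.
  by apply: continuous_quot => //; exact: continuous_sq.
have cY t : continuous (fun t => Derive y t ^ 2 / om t) t.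
  by apply: continuous_quot => //; exact: continuous_sq.
have scale c (g : R -> R) : (forall t, continuous g t) ->
    forall t, continuous (fun t => c * g t) t.
  by move=> cg t; apply: continuous_mul => //; exact: continuous_const.
(* Subtracting a constant from [x] is free, since the integral of [Derive y] over a period
   vanishes. *)
have -> : RInt (fun t => x t * Derive y t) 0 T
          = RInt (fun t => (x t - x0) * Derive y t) 0 T :> R.
  rewrite (@RInt_extR _ (fun t => (x t - x0) * Derive y t + x0 * Derive y t)) => [|t];
    last by ring.
  rewrite RInt_add //; last exact: scale.
  rewrite RInt_scale // RInt_DeriveR // -(Rplus_0_l T) py; ring.
have -> : RInt (fun t => (a * Derive x t ^ 2 + d * Derive y t ^ 2) / om t) 0 T
    = a * RInt (fun t => Derive x t ^ 2 / om t) 0 T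
      + d * RInt (fun t => Derive y t ^ 2 / om t) 0 T :> R.
  rewrite (@RInt_extR _ (fun t => a * (Derive x t ^ 2 / om t) + d * (Derive y t ^ 2 / om t)))
    => [|t]; last by rewrite /Rdiv; ring.
  by rewrite RInt_add ?RInt_scale //; exact: scale.
set X := RInt (fun t => Derive x t ^ 2 / om t) 0 T in wx *.
set Y := RInt (fun t => Derive y t ^ 2 / om t) 0 T.
set S := RInt _ 0 T in wx; set I := RInt _ 0 T.
have cU t : continuous (fun t => a * ((x t - x0) ^ 2 * om t) + d * (Derive y t ^ 2 / om t)) t.
  by apply: continuous_add; exact: scale.
have EU : RInt (fun t => a * ((x t - x0) ^ 2 * om t) + d * (Derive y t ^ 2 / om t)) 0 T
          = a * S + d * Y :> R.
  by rewrite RInt_add ?RInt_scale //; exact: scale.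
(* AM-GM in integrated form, from the square of [a * u * om - e * k * v] and [k ^ 2 = a * d]; the
   two signs of [e] bound the absolute value. *)
have bnd e : e ^ 2 = 1 -> 2 * e * k * I <= a * S + d * Y.
  move=> ee; rewrite -EU -RInt_scale //; apply: RInt_leR => //; [lra|exact: scale|].
  move=> t; set u := x t - x0; set v := Derive y t; have o := om0 t.
  suff : 0 <= (a * u * om t - e * k * v) ^ 2 / (a * om t).
    have -> : (a * u * om t - e * k * v) ^ 2 / (a * om t)
      = a * (u ^ 2 * om t) + (e ^ 2 * k ^ 2) * v ^ 2 / (a * om t) - 2 * e * k * (u * v).
      by field; lra.
    rewrite ee kk; have -> : 1 * (a * d) * v ^ 2 / (a * om t) = d * (v ^ 2 / om t).
      by field; lra.
    by lra.
  apply: Rmult_le_pos; first exact: pow2_ge_0.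
  by apply/Rlt_le/Rinv_0_lt_compat; nra.
have b1 := bnd 1 ltac:(ring); have b2 := bnd (-1) ltac:(ring).
have aSX : a * S <= a * X by apply: Rmult_le_compat_l => //; lra.
apply: (Rmult_le_reg_l k) => //.
have -> : k * (1 / k * (1 / 2 * (a * X + d * Y))) = 1 / 2 * (a * X + d * Y) by field; lra.
by case: (Rcase_abs I) => sI; [rewrite Rabs_left|rewrite Rabs_right] => //; lra.
Qed.

(** With [om = lam * (q + del)] the plane bounds sum to B / 2 times the integral of q^2 / om, which
    is at most L / lam. Thus |J| <= B L / (2 lam) for every positive [lam] with lam L < 2 PI;
    letting [lam] approach 2 PI / L gives the claim, here argued by contradiction instead of a
    limit. *)
Lemma symplectic_isoperimetric (I : finType) (x y : I -> R -> R) (a d : I -> R) (B T : R) :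
  (forall r, 0 < a r) -> (forall r, 0 < d r) -> 0 < T -> 0 <= B ->
  (forall r, 1 / sqrt (a r * d r) <= B) ->
  (forall r, C1 (x r)) -> (forall r, C1 (y r)) ->
  (forall r t, x r (t + T) = x r t) -> (forall r t, y r (t + T) = y r t) ->
  let L := RInt (fun t => sqrt (\big[Rplus/0]_(r : I)
             (a r * Derive (x r) t ^ 2 + d r * Derive (y r) t ^ 2))) 0 T in
  Rabs (RInt (fun t => \big[Rplus/0]_(r : I) (x r t * Derive (y r) t)) 0 T)
  <= B * L ^ 2 / (4 * PI).
Proof.
move=> a0 d0 T0 B0 hB cx cy px py.
set Q := fun r t => a r * Derive (x r) t ^ 2 + d r * Derive (y r) t ^ 2.
set q := fun t => sqrt (\big[Rplus/0]_(r : I) Q r t); move=> L.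
have pi0 := PI_RGT_0.
have Q0 r t : 0 <= Q r t.
  by apply: Rplus_le_le_0_compat; apply: Rmult_le_pos;
    rewrite ?(Rlt_le _ _ (a0 r)) ?(Rlt_le _ _ (d0 r)) //; exact: pow2_ge_0 || exact: Rlt_le.
have q0 t : 0 <= q t by exact: sqrt_pos.
have q2 t : q t ^ 2 = \big[Rplus/0]_(r : I) Q r t.
  by rewrite /q pow2_sqrt //; apply: sumR_ge0 => r; exact: Q0.
have cDx r t : continuous (Derive (x r)) t by have [] := cx r t.
have cDy r t : continuous (Derive (y r)) t by have [] := cy r t.
have cQ r t : continuous (Q r) t.
  by apply: continuous_add; apply: continuous_mul; try exact: continuous_const;
    exact: continuous_sq.
have cq t : continuous q t.
  apply: (continuous_comp (fun t => \big[Rplus/0]_(r : I) Q r t) sqrt).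
    by apply: continuous_sumR => r; exact: cQ.
  exact: continuous_sqrt.
have cxy r t : continuous (fun t => x r t * Derive (y r) t) t.
  by apply: continuous_mul => //; exact: C1_continuous.
have perq t : q (t + T) = q t.
  by rewrite /q /Q; congr sqrt; apply: eq_bigr => r _; rewrite !Derive_periodic.
have L0 : 0 <= L by apply: RInt_ge_0 => [|| t _] //; [lra|exact: ex_RInt_cont].
set J := RInt _ 0 T.
(* The weight lam (q + del) is positive even where the speed q vanishes. *)
have key lam del : 0 < lam -> 0 < del -> lam * (L + del * T) < 2 * PI ->
    Rabs J <= B * L / (2 * lam).
  move=> lam0 del0 W.
  pose om t := lam * (q t + del).
  have co t : continuous om t.
    apply: continuous_mul; first exact: continuous_const.
    by apply: continuous_add => //; exact: continuous_const.
  have om0 t : 0 < om t by apply: Rmult_lt_0_compat => //; have := q0 t; lra.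
  have omn0 t : om t <> 0 by have := om0 t; lra.
  have Wom : RInt om 0 T = lam * (L + del * T) :> R.
    have cqd t : continuous (fun t => q t + del) t.
      by apply: continuous_add => //; exact: continuous_const.
    rewrite RInt_scale // RInt_add //; last by move=> t; exact: continuous_const.
    by rewrite RInt_const /scal /= /mult /=; congr (_ * (_ + _)); ring.
  have cQo r t : continuous (fun t => Q r t / om t) t by exact: continuous_quot.
  have cqo t : continuous (fun t => q t ^ 2 / om t) t.
    by apply: continuous_quot => //; exact: continuous_sq.
  rewrite /J RInt_sumR //; apply: (Rle_trans _ _ _ (Rabs_sumR_le _)).
  apply: (Rle_trans _ (\big[Rplus/0]_(r : I) (B * (1 / 2 * RInt (fun t => Q r t / om t) 0 T)))).
    apply: sumR_le => r.
    apply: (Rle_trans _ _ _ (plane_area_bound (a0 r) (d0 r) T0 (cx r) (cy r) co om0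
             (px r) (py r) _ _)) => [t||]; first by rewrite /om perq.
      by rewrite Wom.
    apply: Rmult_le_compat_r => //; apply: Rmult_le_pos; first lra.
    apply: RInt_ge_0; [lra|exact: (ex_RInt_cont _ _ (cQo r))|move=> t _].
    by apply: Rmult_le_pos; [exact: (Q0 r)|]; apply/Rlt_le/Rinv_0_lt_compat.
  rewrite -!sumR_scal -RInt_sumR // (@RInt_extR _ (fun t => q t ^ 2 / om t)) => [|t];
    last by rewrite q2 /Rdiv [RHS]Rmult_comm sumR_scal; apply: eq_bigr => r _; exact: Rmult_comm.
  have : RInt (fun t => q t ^ 2 / om t) 0 T <= / lam * L.
    rewrite -RInt_scale //; apply: RInt_leR => //; [lra| |].
      by move=> t; apply: continuous_mul => //; exact: continuous_const.
    move=> t; have := q0 t; rewrite /om => qt.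
    suff : 0 <= / lam * q t - q t ^ 2 / (lam * (q t + del)) by lra.
    have -> : / lam * q t - q t ^ 2 / (lam * (q t + del)) = q t * del / (lam * (q t + del)).
      by field; lra.
    apply: Rmult_le_pos; first nra.
    by apply/Rlt_le/Rinv_0_lt_compat; nra.
  move=> h.
  have -> : B * L / (2 * lam) = B * (1 / 2 * (/ lam * L)) by field; lra.
  by apply: Rmult_le_compat_l => //; lra.
case: (Rle_lt_dec (Rabs J) (B * L ^ 2 / (4 * PI))) => // contra; exfalso.
have BL0 : 0 <= B * L by exact: Rmult_le_pos.
have J0 : 0 < Rabs J.
  apply: Rle_lt_trans contra; apply: Rmult_le_pos; first by have := pow2_ge_0 L; nra.
  by apply/Rlt_le/Rinv_0_lt_compat; lra.
have contra4 : B * L ^ 2 < Rabs J * (4 * PI).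
  move: contra => /(Rmult_lt_compat_r (4 * PI) _ _ ltac:(lra)).
  by rewrite /Rdiv Rmult_assoc Rinv_l; lra.
(* If the claim fails, B L / (2 |J|) lies below 2 PI / L and their midpoint serves as [lam]. For L =
   0 both constraints are void and [lam = 1] serves. *)
have [lam [lam0 lamL lamJ]] : exists lam, [/\ 0 < lam, lam * L < 2 * PI & B * L < 2 * lam * Rabs J].
  case: (Rle_lt_or_eq_dec 0 L L0) => [Lp|L00].
    exists ((B * L / (2 * Rabs J) + 2 * PI / L) / 2).
    have i1 : B * L / (2 * Rabs J) < 2 * PI / L.
      apply: (Rmult_lt_reg_r (2 * Rabs J * L)); first nra.
      have -> : B * L / (2 * Rabs J) * (2 * Rabs J * L) = B * L ^ 2 by field; lra.
      have -> : 2 * PI / L * (2 * Rabs J * L) = Rabs J * (4 * PI) by field; lra.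
      by [].
    set u := B * L / _ in i1 *; set v := _ / L in i1 *.
    have v0 : 0 < v by apply: Rdiv_lt_0_compat; lra.
    have u0 : 0 <= u by apply: Rmult_le_pos => //; apply/Rlt_le/Rinv_0_lt_compat; lra.
    have vL : v * L = 2 * PI by rewrite /v; field; lra.
    have uJ : u * (2 * Rabs J) = B * L by rewrite /u; field; lra.
    by split; nra.
  by exists 1; rewrite -L00 Rmult_0_r; split; lra.
(* This [del] spends half of the slack 2 PI - lam L, so the total weight stays below 2 PI. *)
have del0 : 0 < (2 * PI - lam * L) / (2 * lam * T) by apply: Rdiv_lt_0_compat; nra.
have := key lam _ lam0 del0.
have -> : lam * (L + (2 * PI - lam * L) / (2 * lam * T) * T) = lam * L + (2 * PI - lam * L) / 2.
  by field; lra.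
move=> /(_ ltac:(lra)) /(Rmult_le_compat_r (2 * lam) _ _ ltac:(lra)).
by rewrite /Rdiv Rmult_assoc Rinv_l; lra.
Qed.

(** * Heisenberg group and lifts *)

Lemma heis_eq (m : nat) (g h : heis m) :
  (forall r, hx g r = hx h r) -> (forall r, hy g r = hy h r) -> hw g = hw h -> g = h.
Proof.
case: g => gx gy gw; case: h => kx ky kw /= ex ey ->.
by rewrite (functional_extensionality gx kx ex) (functional_extensionality gy ky ey).
Qed.

Lemma point_eq (m : nat) (p q : point m) : pt_s p = pt_s q -> pt_h p = pt_h q -> p = q.
Proof. by case: p q => [s h] [s' h'] /= -> ->. Qed.

Lemma heis_mulA (m : nat) (g h k : heis m) :
  heis_mul (heis_mul g h) k = heis_mul g (heis_mul h k).
Proof.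
apply: heis_eq => [r|r|] /=; try ring.
have -> : \big[Rplus/0]_(r < m) ((hx h r + hx g r) * hy k r)
  = \big[Rplus/0]_(r < m) (hx h r * hy k r) + \big[Rplus/0]_(r < m) (hx g r * hy k r).
  by rewrite -big_split /=; apply: eq_bigr => r _; ring.
have -> : \big[Rplus/0]_(r < m) (hx g r * (hy k r + hy h r))
  = \big[Rplus/0]_(r < m) (hx g r * hy k r) + \big[Rplus/0]_(r < m) (hx g r * hy h r).
  by rewrite -big_split /=; apply: eq_bigr => r _; ring.
by rewrite /=; ring.
Qed.

Lemma heis_mul1 (m : nat) (g : heis m) : heis_mul (heis1 m) g = g.
Proof.
apply: heis_eq => [r|r|] /=; try ring.
rewrite big1 => [|r _] /=; ring.
Qed.

Lemma heis_mulV (m : nat) (g : heis m) : heis_mul (heis_inv g) g = heis1 m.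
Proof.
apply: heis_eq => [r|r|] /=; try ring.
have -> : \big[Rplus/0]_(r < m) (- hx g r * hy g r) = -1 * \big[Rplus/0]_(r < m) (hx g r * hy g r).
  by rewrite sumR_scal; apply: eq_bigr => r _; ring.
by rewrite /=; ring.
Qed.

Section Orbits.

Variables (m : nat) (Gam : heis m -> Prop).
Hypothesis dG : discrete_subgroup Gam.

Lemma orbit_refl (p : point m) : orbit Gam p p.
Proof.
exists (heis1 m); first exact: dsg_one dG.
by apply: point_eq => //=; rewrite heis_mul1.
Qed.

Lemma orbit_act (g : heis m) (p : point m) : Gam g -> orbit Gam (act g p) = orbit Gam p.
Proof.
move=> Gg; apply: functional_extensionality => q; apply: propositional_extensionality.
split=> -[h Gh ->].
  exists (heis_mul h g); first exact: dsg_mul.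
  by apply: point_eq => //=; rewrite heis_mulA.
exists (heis_mul h (heis_inv g)); first by apply: dsg_mul => //; exact: dsg_inv.
by apply: point_eq => //=; rewrite heis_mulA -(heis_mulA (heis_inv g)) heis_mulV heis_mul1.
Qed.

Lemma orbit_pt_s (p q : point m) : orbit Gam p q -> pt_s q = pt_s p.
Proof. by case=> g _ ->. Qed.

(** The product of [h2] with the inverse of [h1], written in coordinates so that its continuity
    along two lifts is visible. *)
Definition heis_quot (h2 h1 : heis m) : heis m :=
  Heis (fun r => hx h2 r - hx h1 r) (fun r => hy h2 r - hy h1 r)
       (hw h2 - hw h1 - \big[Rplus/0]_(r < m) ((hx h2 r - hx h1 r) * hy h1 r)).

Lemma heis_quot_mul (g h : heis m) : heis_quot (heis_mul g h) h = g.
Proof.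
apply: heis_eq => [r|r|] /=; try ring.
rewrite [X in _ - X](eq_bigr (fun r => hx g r * hy h r)) => [|r _] /=; ring.
Qed.

Lemma smooth_at_C1 (gam : R -> point m) : (forall u, smooth_at gam u) ->
  [/\ C1 (fun t => pt_s (gam t)), forall r, C1 (fun t => hx (pt_h (gam t)) r),
      forall r, C1 (fun t => hy (pt_h (gam t)) r) & C1 (fun t => hw (pt_h (gam t)))].
Proof.
move=> sm; split=> [u|r u|r u|u];
  have [h1 h2 h3 h4] := sm u 1%nat; have [k1 k2 k3 k4] := sm u 2%nat; split;
  try exact: h1; try exact: h2; try exact: h3; try exact: h4.
- exact: ex_derive_continuous k1.
- exact: ex_derive_continuous (k2 r).
- exact: ex_derive_continuous (k3 r).
- exact: ex_derive_continuous k4.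
Qed.

Lemma smooth_at_continuous (gam : R -> point m) u : smooth_at gam u ->
  [/\ continuous (fun t => pt_s (gam t)) u, forall r, continuous (fun t => hx (pt_h (gam t)) r) u,
      forall r, continuous (fun t => hy (pt_h (gam t)) r) u
    & continuous (fun t => hw (pt_h (gam t))) u].
Proof.
move=> /(_ 1%nat) [h1 h2 h3 h4].
by split=> [|r|r|]; apply: ex_derive_continuous; [exact: h1|exact: h2|exact: h3|exact: h4].
Qed.

Lemma locally_forall_ord (n : nat) (P : 'I_n -> R -> Prop) (u : R) :
  (forall r, locally u (P r)) -> locally u (fun t => forall r, P r t).
Proof.
move=> hP.
suff : locally u (fun t => forall r, r \in enum 'I_n -> P r t).
  by apply: filter_imp => t ht r; apply: ht; rewrite mem_enum.
elim: (enum 'I_n) => [|r s IH]; first exact: filter_forall.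
apply: filter_imp (filter_and _ _ (hP r) IH) => t [Pr Ps] r'.
by rewrite inE => /orP [/eqP -> //|]; exact: Ps.
Qed.

Lemma continuous_near (f : R -> R) u d : 0 < d -> continuous f u ->
  locally u (fun t => Rabs (f t - f u) < d).
Proof.
by move=> d0 cf; apply: (cf (fun y => Rabs (y - f u) < d)); exists (mkposreal d d0).
Qed.

(* Two lifts differ by an element of Gam depending continuously on the
   parameter, hence locally constant. *)
Lemma lifts_differ_locally (gam1 gam2 : R -> point m) u :
  smooth_at gam1 u -> smooth_at gam2 u ->
  locally u (fun t => orbit Gam (gam1 t) = orbit Gam (gam2 t)) ->
  exists2 g, Gam g & locally u (fun t => gam2 t = act g (gam1 t)).
Proof.
move=> s1 s2 loc.
pose g t := heis_quot (pt_h (gam2 t)) (pt_h (gam1 t)).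
have eqg t : orbit Gam (gam1 t) = orbit Gam (gam2 t) -> Gam (g t) /\ gam2 t = act (g t) (gam1 t).
  move=> e; have := orbit_refl (gam2 t); rewrite -e => -[k Gk e2].
  by rewrite /g e2 /= heis_quot_mul.
have [Gu _] := eqg u (locally_singleton _ _ loc).
have [d d0 hd] := dsg_discrete dG Gu.
exists (g u) => //.
have [_ x1 y1 w1] := smooth_at_continuous s1; have [_ x2 y2 w2] := smooth_at_continuous s2.
have lx : locally u (fun t => forall r, Rabs (hx (g t) r - hx (g u) r) < d).
  apply: locally_forall_ord => r; apply: (continuous_near (f := fun t => hx (g t) r)) => //.
  exact: continuous_sub.
have ly : locally u (fun t => forall r, Rabs (hy (g t) r - hy (g u) r) < d).
  apply: locally_forall_ord => r; apply: (continuous_near (f := fun t => hy (g t) r)) => //.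
  exact: continuous_sub.
have lw : locally u (fun t => Rabs (hw (g t) - hw (g u)) < d).
  apply: (continuous_near (f := fun t => hw (g t))) => //.
  apply: continuous_sub; first exact: continuous_sub.
  by apply: continuous_sumR => r; apply: continuous_mul => //; exact: continuous_sub.
apply: filter_imp (filter_and _ _ loc (filter_and _ _ lx (filter_and _ _ ly lw))).
move=> t [/eqg [Gt e2] [nx [ny nw]]].
by rewrite {1}e2; congr act; apply: hd.
Qed.

Lemma locally_constant (f : R -> R) :
  (forall u, locally u (fun t => f t = f u)) -> forall u v, f u = f v.
Proof.
move=> lc; have lt u v : u < v -> f u = f v.
  apply: (@eq_is_derive R_NormedModule) => t _.
  apply: (is_derive_ext_loc (fun=> f t)); last exact: is_derive_const.
  by apply: filter_imp (lc t) => s ->.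
by move=> u v; case: (Rtotal_order u v) => [/lt|[->|/lt]].
Qed.

(** The translating element is recovered from the lifts by [heis_quot], so the local elements are
    values of one function on the line; local constancy makes it constant. *)
Lemma lifts_differ (gam1 gam2 : R -> point m) :
  (forall u, smooth_at gam1 u) -> (forall u, smooth_at gam2 u) ->
  (forall u, orbit Gam (gam1 u) = orbit Gam (gam2 u)) ->
  exists2 g, Gam g & forall u, gam2 u = act g (gam1 u).
Proof.
move=> s1 s2 e.
pose g t := heis_quot (pt_h (gam2 t)) (pt_h (gam1 t)).
have gE t k : gam2 t = act k (gam1 t) -> g t = k.
  by move=> e2; rewrite /g e2 /= heis_quot_mul.
have glc u : locally u (fun t => g t = g u).
  have [k Gk lk] := lifts_differ_locally (s1 u) (s2 u) (filter_forall _ e).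
  rewrite (gE _ _ (locally_singleton _ _ lk)).
  by apply: filter_imp lk => t /gE.
have gc u : g u = g 0.
  apply: heis_eq => [r|r|].
  - by apply: (locally_constant (f := fun t => hx (g t) r)) => v; apply: filter_imp (glc v) => t ->.
  - by apply: (locally_constant (f := fun t => hy (g t) r)) => v; apply: filter_imp (glc v) => t ->.
  - by apply: (locally_constant (f := fun t => hw (g t))) => v; apply: filter_imp (glc v) => t ->.
have [k Gk lk] := lifts_differ_locally (s1 0) (s2 0) (filter_forall _ e).
have g0 := gE _ _ (locally_singleton _ _ lk).
exists k => // u; have [k' Gk' lk'] := lifts_differ_locally (s1 u) (s2 u) (filter_forall _ e).
have e2 := locally_singleton _ _ lk'.
by rewrite e2 -(gE _ _ e2) gc g0.
Qed.

Lemma velocity_act (gam1 gam2 : R -> point m) g u : smooth_at gam1 u ->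
  locally u (fun t => gam2 t = act g (gam1 t)) ->
  [/\ v_s (velocity gam2 u) = v_s (velocity gam1 u),
      forall r, v_x (velocity gam2 u) r = v_x (velocity gam1 u) r,
      forall r, v_y (velocity gam2 u) r = v_y (velocity gam1 u) r
    & v_w (velocity gam2 u) = v_w (velocity gam1 u)
        + \big[Rplus/0]_(r < m) (hx g r * v_y (velocity gam1 u) r)].
Proof.
move=> /(_ 1%nat) [_ dx dy dw] loc; split=> [|r|r|] /=.
- by apply: Derive_ext_loc; apply: filter_imp loc => t ->.
- rewrite (Derive_ext_loc _ (fun t => hx (pt_h (gam1 t)) r + hx g r)).
    rewrite Derive_plus ?Derive_const ?Rplus_0_r //; first exact: (dx r).
    exact: ex_derive_const.
  by apply: filter_imp loc => t ->.
- rewrite (Derive_ext_loc _ (fun t => hy (pt_h (gam1 t)) r + hy g r)).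
    rewrite Derive_plus ?Derive_const ?Rplus_0_r //; first exact: (dy r).
    exact: ex_derive_const.
  by apply: filter_imp loc => t ->.
apply: is_derive_unique.
apply: (is_derive_ext_loc (fun t => hw (pt_h (gam1 t)) + (hw g
   + \big[Rplus/0]_(r < m) (hx g r * hy (pt_h (gam1 t)) r)))).
  by apply: filter_imp loc => t -> /=; rewrite Rplus_assoc.
apply: (is_derive_plus (fun t => hw (pt_h (gam1 t)))); first exact: (Derive_correct _ _ dw).
rewrite -[X in is_derive _ _ X]Rplus_0_l.
apply: (is_derive_plus (fun=> hw g)); first exact: is_derive_const.
apply: is_derive_sumR => r; apply: is_derive_scal; exact: (Derive_correct _ _ (dy r)).
Qed.

End Orbits.

(** * Extrema over a finite index set *)

(** The fold is seeded with the first value, so the induction keeps the head of the sequence fixed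
    and grows the tail. *)
Lemma max_ord_spec (m : nat) (f : 'I_m -> R) : (0 < m)%nat ->
  exists2 r0, max_ord f = f r0 & forall r, f r <= f r0.
Proof.
move=> m0; suff : forall s : seq 'I_m, s <> [::] -> exists2 r0,
    (if map f s is x :: l then foldr Rmax x l else 0) = f r0
    & forall r, r \in s -> f r <= f r0.
  case/(_ (enum 'I_m)) => [e|r0 e h].
    by have := size_enum_ord m; rewrite e => e0; rewrite -e0 in m0.
  by exists r0 => // r; apply: h; rewrite mem_enum.
case=> // i s _ /=; elim: s => [|j s [r0 e h]] /=.
  by exists i => // r; rewrite inE => /eqP ->; lra.
case: (Rle_dec (f j) (f r0)) => jr.
  exists r0; first by rewrite e Rmax_right.
  by move=> r; rewrite !inE => /or3P [/eqP ->|/eqP -> //|rs]; apply: h; rewrite inE ?eqxx ?rs ?orbT.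
exists j; first by rewrite e Rmax_left //; lra.
move=> r; rewrite !inE => /or3P [/eqP ->|/eqP ->|rs]; try lra.
  by have := h i; rewrite inE eqxx => /(_ isT); lra.
by have := h r; rewrite inE rs orbT => /(_ isT); lra.
Qed.

Lemma min_ord_max_ord (m : nat) (f : 'I_m -> R) :
  min_ord f = - max_ord (fun r => - f r).
Proof.
rewrite /min_ord /max_ord /codom /image_mem.
case: (enum _) => [|i s] /=; first by rewrite Ropp_0.
elim: s => [|j s /= ->]; first by rewrite /= Ropp_involutive.
by rewrite Ropp_Rmax Ropp_involutive.
Qed.

Lemma min_ord_spec (m : nat) (f : 'I_m -> R) : (0 < m)%nat ->
  exists2 r0, min_ord f = f r0 & forall r, f r0 <= f r.
Proof.
move=> m0; have [r0 e h] := max_ord_spec (fun r => - f r) m0.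
exists r0 => [|r]; first by rewrite min_ord_max_ord e Ropp_involutive.
by have := h r; lra.
Qed.

Lemma is_glb_Rbar_open_ray (E : R -> Prop) (l : R) :
  (forall L, E L -> l < L) -> (forall L, l < L -> E L) -> is_glb_Rbar E l.
Proof.
move=> lb att; split=> [L /lb /= lL|b hb]; first exact: Rlt_le.
apply: Rbar_not_lt_le => lb'.
case: b hb lb' => [b| |] hb //= lb'.
  by have /= := hb ((l + b) / 2) (att ((l + b) / 2) ltac:(lra)); lra.
by have := hb (l + 1) (att (l + 1) ltac:(lra)).
Qed.

(** * Smooth trigonometric curves *)

(** A family closed under differentiation, so membership gives derivatives of all orders. It
    contains every coordinate of the elliptic loops, whose central coordinate needs the double
    angle, and of the central lines. *)
Definition trig (a b c d e f : R) (t : R) : R :=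
  a + b * t + c * sin t + d * cos t + e * sin (2 * t) + f * cos (2 * t).

Lemma trig_derive a b c d e f t :
  is_derive (trig a b c d e f) t (trig b 0 (- d) c (- (2 * f)) (2 * e) t).
Proof. by rewrite /trig; auto_derive => //; ring. Qed.

Lemma trig_Derive_n a b c d e f n : exists a' b' c' d' e' f',
  forall t, Derive_n (trig a b c d e f) n t = trig a' b' c' d' e' f' t.
Proof.
elim: n => [|n [a' [b' [c' [d' [e' [f' IH]]]]]]]; first by exists a, b, c, d, e, f.
exists b', 0, (- d'), c', (- (2 * f')), (2 * e') => t /=; rewrite (Derive_ext _ _ _ IH).
exact: (is_derive_unique _ _ _ (trig_derive _ _ _ _ _ _ _)).
Qed.

Lemma trig_smooth g a b c d e f n u : (forall t, g t = trig a b c d e f t) ->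
  ex_derive_n g n u.
Proof.
move=> gE; apply: (ex_derive_n_ext (trig a b c d e f)) => [t|]; first by rewrite gE.
case: n => // n /=; have [a' [b' [c' [d' [e' [f' E]]]]]] := trig_Derive_n a b c d e f n.
apply: (ex_derive_ext (trig a' b' c' d' e' f')) => [t|]; first by rewrite E.
by eexists; exact: trig_derive.
Qed.

(** * Signs of the coefficients and causal character of vectors *)

Section Geometry.

Variables (m : nat) (A : nat -> R) (eps : R).
Hypotheses (hm : (1 <= m)%nat) (hA : forall i : nat, (i <= 2 * m)%nat -> 0 < A i).
Hypothesis heps : eps = 1 \/ eps = -1.

Let A0_gt0 : 0 < A 0%nat. Proof. exact: hA. Qed.

Lemma A_odd_gt0 (r : 'I_m) : 0 < A_odd A r.
Proof. by apply: hA; rewrite !mul2n ltn_double. Qed.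

Lemma A_even_gt0 (r : 'I_m) : 0 < A_even A r.
Proof. by apply: hA; rewrite !mul2n -doubleS leq_double. Qed.

Lemma Fr_ge1 (r : 'I_m) s : 1 <= Fr A r s.
Proof.
rewrite /Fr; suff : 0 <= kappa A r ^ 2 / 16 * s ^ 2 by lra.
by have := pow2_ge_0 (kappa A r); have := pow2_ge_0 s; move=> *; apply: Rmult_le_pos; lra.
Qed.

Lemma Hprod_ge1 s : 1 <= Hprod m A s.
Proof.
apply: (big_ind (fun x => 1 <= x)) => [|x y *|r _]; [lra|nra|exact: Fr_ge1].
Qed.

Lemma coef_a_gt0 (r : 'I_m) s : 0 < coef_a A r s.
Proof.
by have := Fr_ge1 r s; have := A_odd_gt0 r => ? ?; apply: Rmult_lt_0_compat; nra.
Qed.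

Lemma coef_d_gt0 (r : 'I_m) s : 0 < coef_d A r s.
Proof.
by have := Fr_ge1 r s; have := A_even_gt0 r => ? ?; apply: Rmult_lt_0_compat; nra.
Qed.

Lemma coef_c_gt0 s : s < 0 -> 0 < coef_c m A s.
Proof.
move=> s0; rewrite /coef_c; have := Hprod_ge1 s => ?; apply: Rdiv_lt_0_compat; last lra.
by rewrite Rabs_left //; apply: Rmult_lt_0_compat; nra.
Qed.

Lemma sqrt_coef_ad (r : 'I_m) s :
  sqrt (coef_a A r s * coef_d A r s) = Fr A r s * A_odd A r * A_even A r.
Proof.
have -> : coef_a A r s * coef_d A r s = (Fr A r s * A_odd A r * A_even A r) ^ 2.
  by rewrite /coef_a /coef_d; ring.
apply: sqrt_pow2; have := Fr_ge1 r s; have := A_odd_gt0 r; have := A_even_gt0 r => *.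
by apply: Rmult_le_pos; nra.
Qed.

Definition hquad (s : R) (v : tvec m) : R :=
  \big[Rplus/0]_(r < m) (coef_a A r s * v_x v r ^ 2 + coef_d A r s * v_y v r ^ 2).

Lemma hquad_ge0 s v : 0 <= hquad s v.
Proof.
apply: sumR_ge0 => r; have := coef_a_gt0 r s; have := coef_d_gt0 r s.
by have := pow2_ge_0 (v_x v r); have := pow2_ge_0 (v_y v r); nra.
Qed.

Lemma metric_diag (p : point m) (v : tvec m) :
  metric A eps p v v = eps * A 0%nat * (v_s v * eta p v)
    + A 0%nat ^ 2 * pt_s p / Hprod m A (pt_s p) * eta p v ^ 2 + hquad (pt_s p) v.
Proof.
rewrite /metric /hquad; congr (_ + _ + _); [field|ring|].
by apply: eq_bigr => r _; rewrite /coef_a /coef_d; ring.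
Qed.

Lemma metric_slice (p : point m) (v : tvec m) : pt_s p < 0 -> v_s v = 0 ->
  metric A eps p v v = - (coef_c m A (pt_s p) * eta p v ^ 2) + hquad (pt_s p) v.
Proof.
move=> s0 vs; rewrite metric_diag vs /coef_c Rabs_left //.
by have := Hprod_ge1 (pt_s p); move=> *; field; lra.
Qed.

Lemma metric_time_field (p : point m) (v : tvec m) :
  metric A eps p (time_field A eps p) v =
  (eps * A 0%nat * eta p v * (sqrt (1 + pt_s p ^ 2) - 2 * pt_s p)
   - Hprod m A (pt_s p) * v_s v) / (2 * sqrt (1 + pt_s p ^ 2)).
Proof.
have e2 : eps * eps = 1 by case: heps => ->; ring.
have H1 := Hprod_ge1 (pt_s p).
have sg : 0 < sqrt (1 + pt_s p ^ 2) by apply: sqrt_lt_R0; have := pow2_ge_0 (pt_s p); lra.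
rewrite /metric /= big1 => [|r _]; last by ring.
have -> : eta p (time_field A eps p)
          = - (eps * Hprod m A (pt_s p) / (A 0%nat * sqrt (1 + pt_s p ^ 2))).
  by rewrite /eta /= big1 => [|r _]; ring.
set sg' := sqrt _ in sg *.
transitivity ((eps * A 0%nat * eta p v * (sg' - 2 * pt_s p)
   - (eps * eps) * (Hprod m A (pt_s p) * v_s v)) / (2 * sg')).
  by field; lra.
by rewrite e2 Rmult_1_l.
Qed.

(* For s >= 0 the metric is nonnegative on the slice s = const, so timelike vectors
   cannot be tangent to it. *)
Lemma future_timelike_ds_gt0 (p : point m) (v : tvec m) :
  0 <= pt_s p -> future_timelike A eps p v -> 0 < v_s v.
Proof.
move=> s0 []; rewrite /timelike metric_diag metric_time_field => tl fut.
have H1 := Hprod_ge1 (pt_s p); have Q0 := hquad_ge0 (pt_s p) v.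
set s := pt_s p in s0 tl fut H1 Q0 *; set H := Hprod _ _ _ in tl fut H1.
set e := eta p v in tl fut; set a := v_s v in tl fut *.
have sg : s < sqrt (1 + s ^ 2).
  rewrite -{1}(sqrt_pow2 s s0); apply: sqrt_lt_1; have := pow2_ge_0 s; lra.
set sg' := sqrt _ in sg fut.
have {}fut : eps * A 0%nat * e * (sg' - 2 * s) - H * a < 0.
  move: fut => /(Rmult_lt_compat_r (2 * sg') _ _ ltac:(lra)).
  by rewrite /Rdiv Rmult_assoc Rinv_l; lra.
set E := eps * A 0%nat * e in fut.
have {tl} tl : a * E + s / H * E ^ 2 < 0.
  have -> : a * E + s / H * E ^ 2
     = eps * A 0%nat * (a * e) + A 0%nat ^ 2 * s / H * e ^ 2 * (eps * eps).
    by rewrite /E; field; lra.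
  have -> : eps * eps = 1 by case: heps => ->; ring.
  lra.
have {tl} tl : a * E * H + s * E ^ 2 < 0.
  move: tl => /(Rmult_lt_compat_r H _ _ ltac:(lra)).
  have -> : (a * E + s / H * E ^ 2) * H = a * E * H + s * E ^ 2 by field; lra.
  by rewrite Rmult_0_l.
case: (Rlt_le_dec 0 a) => // a0; exfalso.
have sE : 0 <= s * E ^ 2 by apply: Rmult_le_pos => //; exact: pow2_ge_0.
have aH : a * H <= 0 by nra.
have E0 : 0 < E.
  case: (Rlt_le_dec 0 E) => // E0; have : 0 <= a * H * E by nra.
  by lra.
(* Timelikeness divided by [E]. Together with [fut] it gives [E * (sg' - s) < 0], against [0 < E]
   and [s < sg']. *)
have : a * H + s * E < 0 by nra.
by nra.
Qed.

(** For vectors tangent to the slice the pairing with the time field is a multiple of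
    [eps * eta p v], with a factor that is positive because sqrt(1 + s^2) - 2 s > 0 for negative
    s. *)
Lemma future_timelike_slice (p : point m) (v : tvec m) : pt_s p < 0 -> v_s v = 0 ->
  timelike A eps p v -> eps * eta p v < 0 -> future_timelike A eps p v.
Proof.
move=> s0 vs tl e0; split=> //; rewrite metric_time_field vs Rmult_0_r Rminus_0_r.
have sg : 0 < sqrt (1 + pt_s p ^ 2) by apply: sqrt_lt_R0; have := pow2_ge_0 (pt_s p); lra.
suff : 0 < - (eps * A 0%nat * eta p v * (sqrt (1 + pt_s p ^ 2) - 2 * pt_s p))
           / (2 * sqrt (1 + pt_s p ^ 2)) by rewrite Rdiv_opp_l; lra.
apply: Rdiv_lt_0_compat; last lra.
have -> : - (eps * A 0%nat * eta p v * (sqrt (1 + pt_s p ^ 2) - 2 * pt_s p))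
  = - (eps * eta p v) * (A 0%nat * (sqrt (1 + pt_s p ^ 2) - 2 * pt_s p)) by ring.
by apply: Rmult_lt_0_compat; [lra|apply: Rmult_lt_0_compat; lra].
Qed.

(** Left invariance of [eta]: the translation adds the same sum to the central velocity as to the
    term in x dy. *)
Lemma eta_act (gam1 gam2 : R -> point m) g u : smooth_at gam1 u ->
  locally u (fun t => gam2 t = act g (gam1 t)) ->
  eta (gam2 u) (velocity gam2 u) = eta (gam1 u) (velocity gam1 u).
Proof.
move=> sm loc; have [_ _ vy vw] := velocity_act sm loc.
rewrite /eta vw (locally_singleton _ _ loc).
have -> : \big[Rplus/0]_(r < m) (hx (pt_h (act g (gam1 u))) r * v_y (velocity gam2 u) r)
  = \big[Rplus/0]_(r < m) (hx (pt_h (gam1 u)) r * v_y (velocity gam1 u) r)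
    + \big[Rplus/0]_(r < m) (hx g r * v_y (velocity gam1 u) r).
  by rewrite -big_split; apply: eq_bigr => r _; rewrite vy /=; ring.
by rewrite /=; ring.
Qed.

Lemma hquad_act (gam1 gam2 : R -> point m) g u s : smooth_at gam1 u ->
  locally u (fun t => gam2 t = act g (gam1 t)) ->
  hquad s (velocity gam2 u) = hquad s (velocity gam1 u).
Proof.
move=> sm loc; have [_ vx vy _] := velocity_act sm loc.
by apply: eq_bigr => r _; rewrite vx vy.
Qed.

Lemma timelike_act (gam1 gam2 : R -> point m) g u : smooth_at gam1 u ->
  locally u (fun t => gam2 t = act g (gam1 t)) ->
  timelike A eps (gam1 u) (velocity gam1 u) -> timelike A eps (gam2 u) (velocity gam2 u).
Proof.
move=> sm loc; have [vs _ _ _] := velocity_act sm loc.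
rewrite /timelike !metric_diag (eta_act sm loc) (hquad_act _ sm loc) vs.
by rewrite (locally_singleton _ _ loc).
Qed.


(** * Closed timelike curves stay in the region of negative s *)

Lemma is_derive_gt0_right (f : R -> R) (u : R) (P : R -> Prop) :
  ex_derive f u -> 0 < Derive f u -> locally u P ->
  exists t, [/\ u < t, P t & f u < f t].
Proof.
move=> /Derive_correct /is_derive_Reals df l0 [e he].
have [d hd] := df _ l0; have d0 := cond_pos d; have e0 := cond_pos e.
have m0 : 0 < Rmin d e by exact: Rmin_pos.
have md := Rmin_l d e; have me := Rmin_r d e.
set h := Rmin d e / 2.
exists (u + h); split; first by rewrite /h; lra.
  by apply: he; rewrite /ball /= /AbsRing_ball /abs /minus /plus /opp /= Rabs_right /h; lra.
have /Rabs_def2 [_] : Rabs ((f (u + h) - f u) / h - Derive f u) < Derive f u.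
  by apply: hd; rewrite /h ?Rabs_right; lra.
move=> q; have {q} : 0 < (f (u + h) - f u) / h by lra.
have h0 : 0 < h by rewrite /h; lra.
move=> /(Rmult_lt_compat_r h _ _ h0); rewrite Rmult_0_l /Rdiv Rmult_assoc Rinv_l; lra.
Qed.

(* A periodic function attains its maximum, where no right derivative can be
   positive. *)
Lemma periodic_growth_negative (S : R -> R) (T : R) : 0 < T ->
  (forall u, S (u + T) = S u) ->
  (forall u, exists f, [/\ locally u (fun t => u <= t -> S t = f t), ex_derive f u &
                           0 <= S u -> 0 < Derive f u]) ->
  (forall u, exists2 f, locally u (fun t => t <= u -> S t = f t) & continuous f u) ->
  forall u, S u < 0.
Proof.
move=> T0 per right left u0; case: (Rlt_le_dec (S u0) 0) => // Su0; exfalso.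
have cS u : continuous S u.
  have [f [Sf df _]] := right u; have [k Sk ck] := left u.
  have cf : continuous f u by exact: ex_derive_continuous.
  apply/filterlim_locally => e.
  have fu : S u = f u by apply: (locally_singleton _ _ Sf); lra.
  have ku : S u = k u by apply: (locally_singleton _ _ Sk); lra.
  have lf : locally u (fun t => ball (f u) e (f t)) by move/filterlim_locally: cf; exact.
  have lk : locally u (fun t => ball (k u) e (k t)) by move/filterlim_locally: ck; exact.
  apply: filter_imp (filter_and _ _ (filter_and _ _ Sf Sk) (filter_and _ _ lf lk)).
  move=> t [[tf tk] [bf bk]]; case: (Rle_lt_dec u t) => ut.
    by rewrite fu (tf ut).
  by rewrite ku (tk (Rlt_le _ _ ut)).
have [|M [hM [M1 M2]]] := continuity_ab_maj S u0 (u0 + T) ltac:(lra).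
  by move=> c _; apply/continuity_pt_filterlim; exact: cS.
(* The maximum must leave room to its right inside the period; if it sits at the right end,
   periodicity moves it to the left end. *)
have [N [N1 N2 hN]] : exists N, [/\ u0 <= N, N < u0 + T &
    forall c, u0 <= c <= u0 + T -> S c <= S N].
  case: (Rle_lt_or_eq_dec _ _ M2) => [lt|e]; first by exists M.
  by exists u0; split; [lra|lra|move=> c /hM; rewrite e per].
have [f [Sf df pos]] := right N.
have fN : S N = f N by apply: (locally_singleton _ _ Sf); lra.
have SN : 0 <= S N by have := hN u0 ltac:(lra); lra.
have NT : locally N (fun t => t < u0 + T).
  have d0 : 0 < u0 + T - N by lra.
  by exists (mkposreal _ d0) => t /Rabs_def2 /=; rewrite /minus /plus /opp /=; lra.
have [t [Nt [tT ft] lt]] := is_derive_gt0_right df (pos SN) (filter_and _ _ NT Sf).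
by have := hN t ltac:(lra); rewrite fN ft; lra.
Qed.

(** Translations fix s, so s descends to orbits; representatives are chosen only to read it off, and
    locally it is the s-coordinate of the lifted germs. *)
Lemma chronology_violating_quot_lt0 (Gam : heis m -> Prop) (p : point m) :
  discrete_subgroup Gam ->
  chronology_violating_quot A eps Gam (orbit Gam p) -> pt_s p < 0.
Proof.
move=> dG [c [T [u0 [[T0 per loc] cu0]]]].
have rep u : {q | c u q}.
  apply: constructive_indefinite_description.
  have [[gam /locally_singleton [_ /(_ ltac:(lra)) [-> _]]] _] := loc u.
  by exists (gam u); exact: orbit_refl.
pose S u := pt_s (sval (rep u)).
have SE u q : c u = orbit Gam q -> S u = pt_s q.
  by move=> e; apply: (orbit_pt_s (Gam := Gam)); rewrite -e; exact: (svalP (rep u)).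
rewrite -(SE _ _ cu0); apply: (periodic_growth_negative T0) => u.
- have [[gam /locally_singleton [_ /(_ ltac:(lra)) [e _]]] _] := loc u.
  by rewrite (SE _ _ e); apply: SE; rewrite per.
- have [[gam lg] _] := loc u; exists (fun t => pt_s (gam t)).
  have [sm /(_ ltac:(lra)) [e fut]] := locally_singleton _ _ lg.
  split; first by apply: filter_imp lg => t [_ h] ut; apply: SE; have [] := h ut.
    by have [] := sm 1%nat.
  by rewrite (SE _ _ e) => s0; exact: future_timelike_ds_gt0 fut.
- have [_ [gam lg]] := loc u; exists (fun t => pt_s (gam t)).
    by apply: filter_imp lg => t [_ h] ut; apply: SE; have [] := h ut.
  by have [sm _] := locally_singleton _ _ lg; have [] := smooth_at_continuous sm.
Qed.

Lemma chronology_violating_orbit (Gam : heis m -> Prop) (p : point m) :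
  chronology_violating A eps p -> chronology_violating_quot A eps Gam (orbit Gam p).
Proof.
move=> [gam [T [u [[T0 per loc] gu]]]].
exists (fun t => orbit Gam (gam t)), T, u; split; last by rewrite gu.
split=> // t; first by rewrite per.
have [[g1 l1] [g2 l2]] := loc t; split.
  by exists g1; apply: filter_imp l1 => v [sm h]; split=> // /h [-> ].
by exists g2; apply: filter_imp l2 => v [sm h]; split=> // /h [-> ].
Qed.

(** Presents the cover as the quotient by the trivial group, so that the growth argument on
    quotients also settles the cover. *)
Lemma discrete_subgroup_trivial : discrete_subgroup (fun g : heis m => g = heis1 m).
Proof.
split=> // [g h -> ->|g ->|g ->]; first exact: heis_mul1.
  by apply: heis_eq => [r|r|] /=; rewrite ?big1; try ring; move=> r _; ring.
by exists 1; [lra|].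
Qed.

Lemma chronology_violating_lt0 (p : point m) : chronology_violating A eps p -> pt_s p < 0.
Proof.
move=> /(chronology_violating_orbit (fun g => g = heis1 m)).
exact: chronology_violating_quot_lt0 discrete_subgroup_trivial.
Qed.

(** * Elliptic loops *)

(* The central coordinate is the one for which eta is constant along the loop;
   that constant is then forced by periodicity. *)
Definition ellipse (s : R) (h : heis m) (r0 : 'I_m) (al be : R) (u : R) : point m :=
  Point s (Heis (fun r => hx h r + if r == r0 then al * (cos u - 1) else 0)
                (fun r => hy h r + if r == r0 then be * sin u else 0)
                (hw h + (hx h r0 - al) * be * sin u + al * be / 4 * sin (2 * u))).

Section Ellipse.

Variables (s : R) (h : heis m) (r0 : 'I_m) (al be : R).
Let gam := ellipse s h r0 al be.

Lemma ellipse_smooth u : smooth_at gam u.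
Proof.
move=> n; split=> [|r|r|] /=.
- by apply: (@trig_smooth _ s 0 0 0 0 0) => t; rewrite /trig; ring.
- case: (r == r0).
    by apply: (@trig_smooth _ (hx h r - al) 0 0 al 0 0) => t; rewrite /trig; ring.
  by apply: (@trig_smooth _ (hx h r) 0 0 0 0 0) => t; rewrite /trig; ring.
- case: (r == r0).
    by apply: (@trig_smooth _ (hy h r) 0 be 0 0 0) => t; rewrite /trig; ring.
  by apply: (@trig_smooth _ (hy h r) 0 0 0 0 0) => t; rewrite /trig; ring.
- by apply: (@trig_smooth _ (hw h) 0 ((hx h r0 - al) * be) 0 (al * be / 4) 0) => t;
    rewrite /trig; ring.
Qed.

Lemma ellipse_periodic u : gam (u + 2 * PI) = gam u.
Proof.
rewrite /gam /ellipse cos_plus sin_plus cos_2PI sin_2PI.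
have -> : 2 * (u + 2 * PI) = 2 * u + 2 * PI + 2 * PI by ring.
rewrite !(sin_plus _ (2 * PI)) !cos_2PI !sin_2PI.
by rewrite !Rmult_0_r !Rmult_1_r Rminus_0_r !Rplus_0_r.
Qed.

Lemma ellipse_start : gam 0 = Point s h.
Proof.
apply: point_eq => //; apply: heis_eq => [r|r|] /=.
- by case: (r == r0); rewrite ?cos_0; ring.
- by case: (r == r0); rewrite ?sin_0; ring.
- by rewrite Rmult_0_r sin_0; ring.
Qed.

Lemma velocity_ellipse u :
  [/\ v_s (velocity gam u) = 0,
      forall r, v_x (velocity gam u) r = if r == r0 then - (al * sin u) else 0,
      forall r, v_y (velocity gam u) r = if r == r0 then be * cos u else 0
    & v_w (velocity gam u) = (hx h r0 - al) * be * cos u + al * be / 2 * cos (2 * u)].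
Proof.
split=> [|r|r|] /=; first exact: Derive_const.
- by apply: is_derive_unique; case: (r == r0); auto_derive => //; ring.
- by apply: is_derive_unique; case: (r == r0); auto_derive => //; ring.
- by apply: is_derive_unique; auto_derive => //; field.
Qed.

Lemma eta_ellipse u : eta (gam u) (velocity gam u) = - (al * be / 2).
Proof.
have [_ _ vy vw] := velocity_ellipse u.
rewrite /eta vw (@sumR_delta _ r0) => [|r rr0]; last by rewrite vy (negbTE rr0) Rmult_0_r.
by rewrite vy eqxx /= eqxx cos_2a_cos; field.
Qed.

Lemma hquad_ellipse rho u : coef_a A r0 s * al ^ 2 = rho ^ 2 ->
  coef_d A r0 s * be ^ 2 = rho ^ 2 -> hquad s (velocity gam u) = rho ^ 2.
Proof.
move=> ea ed; have [_ vx vy _] := velocity_ellipse u.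
rewrite /hquad (@sumR_delta _ r0) => [|r rr0].
  rewrite vx vy eqxx.
  have -> : coef_a A r0 s * (- (al * sin u)) ^ 2 + coef_d A r0 s * (be * cos u) ^ 2
    = (coef_a A r0 s * al ^ 2) * Rsqr (sin u) + (coef_d A r0 s * be ^ 2) * Rsqr (cos u).
    by rewrite /Rsqr; ring.
  by rewrite ea ed -Rmult_plus_distr_l sin2_cos2 Rmult_1_r.
by rewrite vx vy (negbTE rr0); ring.
Qed.

End Ellipse.

(* rho is the horizontal radius; the enclosed area is signed by eps, which makes
   the loop future directed. *)
Definition round_loop (s : R) (h : heis m) (r0 : 'I_m) (rho : R) : R -> point m :=
  ellipse s h r0 (rho / sqrt (coef_a A r0 s)) (eps * (rho / sqrt (coef_d A r0 s))).

Lemma hquad_round_loop s h r0 rho u :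
  hquad s (velocity (round_loop s h r0 rho) u) = rho ^ 2.
Proof.
have e2 : eps * eps = 1 by case: heps => ->; ring.
have a0 := coef_a_gt0 r0 s; have d0 := coef_d_gt0 r0 s.
have sa := sqrt_lt_R0 _ a0; have sd := sqrt_lt_R0 _ d0.
apply: hquad_ellipse.
  by rewrite -{1}(sqrt_def _ (Rlt_le _ _ a0)); field; lra.
transitivity ((eps * eps) * rho ^ 2); last by rewrite e2; ring.
by rewrite -{1}(sqrt_def _ (Rlt_le _ _ d0)); field; lra.
Qed.

Lemma eta_round_loop s h r0 rho u :
  eta (round_loop s h r0 rho u) (velocity (round_loop s h r0 rho) u)
  = - (eps * (rho ^ 2 / (2 * sqrt (coef_a A r0 s * coef_d A r0 s)))).
Proof.
have a0 := coef_a_gt0 r0 s; have d0 := coef_d_gt0 r0 s.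
have sa := sqrt_lt_R0 _ a0; have sd := sqrt_lt_R0 _ d0.
by rewrite eta_ellipse sqrt_mult; try lra; field; lra.
Qed.

(** The causal character is constant along the loop and changes at the radius with c rho^2 = 4 a d,
    where the bracket vanishes. *)
Lemma metric_round_loop s h r0 rho u : s < 0 ->
  let v := velocity (round_loop s h r0 rho) u in
  metric A eps (round_loop s h r0 rho u) v v
  = rho ^ 2 * (1 - coef_c m A s * rho ^ 2 / (4 * (coef_a A r0 s * coef_d A r0 s))).
Proof.
move=> s0 v; have e2 : eps * eps = 1 by case: heps => ->; ring.
have [vs _ _ _] := velocity_ellipse s h r0 (rho / sqrt (coef_a A r0 s))
                     (eps * (rho / sqrt (coef_d A r0 s))) u.
rewrite metric_slice // hquad_round_loop eta_round_loop /=.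
have ad : 0 < coef_a A r0 s * coef_d A r0 s.
  by apply: Rmult_lt_0_compat; [exact: coef_a_gt0|exact: coef_d_gt0].
have sad := sqrt_lt_R0 _ ad; rewrite -{3}(sqrt_def _ (Rlt_le _ _ ad)).
set k := sqrt _ in sad *.
transitivity (rho ^ 2 * (1 - (eps * eps) * (coef_c m A s * rho ^ 2 / (4 * (k * k))))).
  by field; lra.
by rewrite e2 Rmult_1_l.
Qed.

Lemma round_loop_slice (K : point m -> tvec m -> Prop) s h r0 rho :
  (forall u, K (round_loop s h r0 rho u) (velocity (round_loop s h r0 rho) u)) ->
  slice_loop K s (round_loop s h r0 rho) (2 * PI).
Proof.
move=> hK; have := PI_RGT_0 => pi0; split=> //; [lra|exact: ellipse_periodic|].
by move=> u; split=> //; exact: ellipse_smooth.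
Qed.

Lemma hlength_round_loop s h r0 rho : 0 <= rho ->
  hlength A s (round_loop s h r0 rho) (2 * PI) = 2 * PI * rho.
Proof.
move=> rho0; rewrite /hlength (@RInt_extR _ (fun=> rho)) => [|u].
  by rewrite RInt_const /scal /= /mult /=; ring.
by rewrite -[RHS]sqrt_pow2 // -(hquad_round_loop s h r0 rho u).
Qed.

Lemma round_loop_timelike s h r0 rho u : s < 0 -> 0 < rho ->
  4 * (coef_a A r0 s * coef_d A r0 s) < coef_c m A s * rho ^ 2 ->
  timelike A eps (round_loop s h r0 rho u) (velocity (round_loop s h r0 rho) u).
Proof.
move=> s0 rho0 big; rewrite /timelike metric_round_loop //.
have ad : 0 < coef_a A r0 s * coef_d A r0 s.
  by apply: Rmult_lt_0_compat; [exact: coef_a_gt0|exact: coef_d_gt0].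
have : 1 < coef_c m A s * rho ^ 2 / (4 * (coef_a A r0 s * coef_d A r0 s)).
  by apply/Rlt_div_r; lra.
have r2 : 0 < rho ^ 2 by nra.
by nra.
Qed.

Lemma timelike_loop_through (p : point m) : pt_s p < 0 ->
  exists gam, [/\ slice_loop (timelike A eps) (pt_s p) gam (2 * PI), gam 0 = p &
                  forall u, future_timelike A eps (gam u) (velocity gam u)].
Proof.
move=> s0; pose r0 : 'I_m := Ordinal hm; set s := pt_s p in s0 *.
have ad : 0 < coef_a A r0 s * coef_d A r0 s.
  by apply: Rmult_lt_0_compat; [exact: coef_a_gt0|exact: coef_d_gt0].
have c0 := coef_c_gt0 s0.
(* Since [rho > 1], c rho^2 exceeds c rho = c + 4 a d, which is beyond the threshold. *)
pose rho := 1 + 4 * (coef_a A r0 s * coef_d A r0 s) / coef_c m A s.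
have rho1 : 1 < rho.
  by rewrite /rho; suff : 0 < 4 * (coef_a A r0 s * coef_d A r0 s) / coef_c m A s;
    [lra|apply: Rdiv_lt_0_compat; lra].
have big : 4 * (coef_a A r0 s * coef_d A r0 s) < coef_c m A s * rho ^ 2.
  have : coef_c m A s * rho = coef_c m A s + 4 * (coef_a A r0 s * coef_d A r0 s).
    by rewrite /rho; field; lra.
  by nra.
have tl u := round_loop_timelike (pt_h p) u s0 (ltac:(lra) : 0 < rho) big.
exists (round_loop s (pt_h p) r0 rho); split.
- exact: round_loop_slice.
- by rewrite /round_loop ellipse_start; exact: point_eq.
move=> u; apply: future_timelike_slice => //.
  by have [] := velocity_ellipse s (pt_h p) r0 (rho / sqrt (coef_a A r0 s))
                     (eps * (rho / sqrt (coef_d A r0 s))) u.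
rewrite eta_round_loop.
have : 0 < rho ^ 2 / (2 * sqrt (coef_a A r0 s * coef_d A r0 s)).
  by apply: Rdiv_lt_0_compat; [nra|have := sqrt_lt_R0 _ ad; lra].
by case: heps => ->; lra.
Qed.

Lemma chronology_violating_of_lt0 (p : point m) :
  pt_s p < 0 -> chronology_violating A eps p.
Proof.
move=> /timelike_loop_through [gam [[T0 per _ sm] g0 fut]].
exists gam, (2 * PI), 0; split=> //; split=> // u.
by split; exists gam; apply: filter_forall => t; have [? _] := sm t.
Qed.

Lemma slice_loop_orbit (K : point m -> tvec m -> Prop) (Gam : heis m -> Prop) s gam T :
  slice_loop K s gam T -> slice_loop_quot K Gam s (fun u => orbit Gam (gam u)) T.
Proof.
move=> [T0 per ss sm]; split=> // [u|u p /orbit_pt_s ->|u] //; first by rewrite per.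
exists gam; last by have [] := sm u.
by apply: filter_forall => t; have [] := sm t.
Qed.

(** * Horizontal lengths *)

Lemma Bmax_spec s : exists2 r0 : 'I_m,
  Bmax m A s = 1 / sqrt (coef_a A r0 s * coef_d A r0 s)
  & forall r : 'I_m, 1 / sqrt (coef_a A r s * coef_d A r s) <= Bmax m A s.
Proof.
have [r0 e h] := max_ord_spec (fun r : 'I_m => 1 / sqrt (coef_a A r s * coef_d A r s)) hm.
by exists r0 => // r; rewrite /Bmax e.
Qed.

Lemma sqrt_coef_ad_gt0 (r : 'I_m) s : 0 < sqrt (coef_a A r s * coef_d A r s).
Proof.
by apply: sqrt_lt_R0; apply: Rmult_lt_0_compat; [exact: coef_a_gt0|exact: coef_d_gt0].
Qed.

Lemma Bmax_gt0 s : 0 < Bmax m A s.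
Proof.
have [r0 -> _] := Bmax_spec s; have := sqrt_coef_ad_gt0 r0 s => ?.
by apply: Rdiv_lt_0_compat; lra.
Qed.

(** The plane realizing [Bmax] has the smallest sqrt(a d), hence the smallest threshold radius 2
    sqrt(a d) / sqrt c; [Lstar] is the horizontal length of the loop of that radius. *)
Lemma Lstar_radius s : s < 0 -> exists (r0 : 'I_m) rho, [/\ 0 < rho,
  coef_c m A s * rho ^ 2 = 4 * (coef_a A r0 s * coef_d A r0 s) & Lstar m A s = 2 * PI * rho].
Proof.
move=> s0; have [r0 eB _] := Bmax_spec s; have k0 := sqrt_coef_ad_gt0 r0 s.
have c0 := coef_c_gt0 s0; have sc := sqrt_lt_R0 _ c0.
exists r0, (2 * sqrt (coef_a A r0 s * coef_d A r0 s) / sqrt (coef_c m A s)); split.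
- by apply: Rdiv_lt_0_compat; lra.
- have ad : 0 <= coef_a A r0 s * coef_d A r0 s.
    by apply/Rlt_le/Rmult_lt_0_compat; [exact: coef_a_gt0|exact: coef_d_gt0].
  rewrite -{1}(sqrt_def _ (Rlt_le _ _ c0)) -{2}(sqrt_def _ ad); field; lra.
- by rewrite /Lstar eB; field; lra.
Qed.

Lemma Lstar_min_ord s : s < 0 -> Lstar m A s =
  4 * PI * sqrt (Hprod m A s) / (A 0%nat * sqrt (Rabs s))
    * min_ord (fun r : 'I_m => Fr A r s * A_odd A r * A_even A r).
Proof.
move=> s0; have [r0 eB hB] := Bmax_spec s.
have [r1 -> h1] := min_ord_spec (fun r : 'I_m => Fr A r s * A_odd A r * A_even A r) hm.
have k0 := sqrt_coef_ad_gt0 r0 s; have k1 := sqrt_coef_ad_gt0 r1 s.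
have := hB r1; rewrite eB !sqrt_coef_ad in k0 k1 * => h.
(* The indices realizing the maximum and the minimum may differ; the values agree because inversion
   reverses the order of positive numbers. *)
have e : Fr A r0 s * A_odd A r0 * A_even A r0 = Fr A r1 s * A_odd A r1 * A_even A r1.
  apply: Rle_antisym; last exact: h1.
  move: h; rewrite /Rdiv !Rmult_1_l => h; apply: Rnot_lt_le => lt.
  by have := Rinv_lt_contravar _ _ (Rmult_lt_0_compat _ _ k1 k0) lt; lra.
rewrite /Lstar eB sqrt_coef_ad -e.
have H1 := Hprod_ge1 s; have sH : 0 < sqrt (Hprod m A s) by apply: sqrt_lt_R0; lra.
have as0 : 0 < Rabs s by apply: Rabs_pos_lt; lra.
have ss := sqrt_lt_R0 _ as0.
have -> : sqrt (coef_c m A s) = A 0%nat * sqrt (Rabs s) / sqrt (Hprod m A s).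
  by rewrite /coef_c sqrt_div ?(sqrt_mult (_ ^ 2)) ?sqrt_pow2; try nra.
have F1 := Fr_ge1 r0 s; have Ao := A_odd_gt0 r0; have Ae := A_even_gt0 r0.
by field; lra.
Qed.

(** Timelikeness in a slice keeps [eta] of the velocity away from zero. Its constant sign lets the
    absolute value be integrated as a signed quantity, which closedness then evaluates. *)
Lemma continuous_const_sign (f : R -> R) : (forall t, continuous f t) ->
  (forall t, f t <> 0) -> exists2 sg, sg = 1 \/ sg = -1 & forall t, 0 < sg * f t.
Proof.
move=> cf f0.
have ctn : continuity f by move=> t; apply/continuity_pt_filterlim; exact: cf.
have same t : 0 < f 0 * f t.
  case: (Rlt_le_dec 0 (f 0 * f t)) => // le; exfalso.
  case: (Rle_lt_dec 0 t) => t0.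
    by have [z [_ /f0]] := IVT_cor f 0 t ctn t0 le.
  by have [|z [_ /f0]] := IVT_cor f t 0 ctn (Rlt_le _ _ t0); first by lra.
case: (Rtotal_order (f 0) 0) => [neg|[/f0 //|pos]].
  by exists (-1); [right|move=> t; have := same t; nra].
by exists 1; [left|move=> t; have := same t; nra].
Qed.

(* Closedness gives int eta = - int x dy, whose size the isoperimetric inequality
   bounds by B L^2 / (4 pi), while timelikeness makes sqrt c |int eta| exceed L. *)
Lemma Lstar_lt_hlength s (gam : R -> point m) T : s < 0 -> slice_loop (timelike A eps) s gam T ->
  Lstar m A s < hlength A s gam T.
Proof.
move=> s0 [T0 per ss sm].
have [_ cx cy cw] := smooth_at_C1 (fun u => proj1 (sm u)).
pose x r t := hx (pt_h (gam t)) r; pose y r t := hy (pt_h (gam t)) r.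
pose xdy t := \big[Rplus/0]_(r < m) (x r t * Derive (y r) t).
pose et t := Derive (fun t => hw (pt_h (gam t))) t - xdy t.
pose q t := hspeed A s (velocity gam t).
have px r t : x r (t + T) = x r t by rewrite /x per.
have py r t : y r (t + T) = y r t by rewrite /y per.
have cxdy t : continuous xdy t.
  apply: continuous_sumR => r; apply: continuous_mul; first exact: (C1_continuous (cx r)).
  by have [] := cy r t.
have cw' t : continuous (Derive (fun t => hw (pt_h (gam t)))) t by have [] := cw t.
have cet t : continuous et t by exact: continuous_sub.
have cq t : continuous q t.
  apply: (continuous_comp (fun t => hquad s (velocity gam t)) sqrt); last exact: continuous_sqrt.
  apply: continuous_sumR => r; apply: continuous_add;
    apply: continuous_mul; try exact: continuous_const; apply: continuous_sq.
    by have [] := cx r t.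
  by have [] := cy r t.
have c0 := coef_c_gt0 s0; have sc := sqrt_lt_R0 _ c0.
have B0 := Bmax_gt0 s; have pi0 := PI_RGT_0.
have tl t : q t ^ 2 < coef_c m A s * et t ^ 2.
  have [_] := sm t; rewrite /timelike metric_slice ?ss //; last first.
    by rewrite /= (Derive_ext _ (fun=> s)) ?Derive_const.
  rewrite /q /hspeed pow2_sqrt; last exact: hquad_ge0.
  by rewrite -/(hquad _ _) /et -/(eta (gam t) (velocity gam t)); lra.
have et0 t : et t <> 0 by move=> e; have := tl t; have := pow2_ge_0 (q t); rewrite e; nra.
have [sg sg1 hsg] := continuous_const_sign cet et0.
have sg2 : sg ^ 2 = 1 by case: sg1 => ->; ring.
have qlt t : q t < sqrt (coef_c m A s) * sg * et t.
  set Z := _ * et t.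
  have Z0 : 0 < Z by rewrite /Z Rmult_assoc; exact: Rmult_lt_0_compat.
  have Z2 : Z ^ 2 = coef_c m A s * et t ^ 2.
    transitivity (sqrt (coef_c m A s) * sqrt (coef_c m A s) * sg ^ 2 * et t ^ 2).
      by rewrite /Z; ring.
    by rewrite sg2 sqrt_def; lra.
  by have := tl t; rewrite -Z2; nra.
have EI : RInt et 0 T = - RInt xdy 0 T :> R.
  rewrite (@RInt_extR et (fun t => Derive (fun t => hw (pt_h (gam t))) t + (-1) * xdy t)) => [|t];
    last by rewrite /et; ring.
  rewrite RInt_add ?RInt_scale //; last first.
    by move=> t; apply: continuous_mul => //; exact: continuous_const.
  by rewrite RInt_DeriveR // -{1}(Rplus_0_l T) per; ring.
have [r0 _ hB] := Bmax_spec s.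
have := symplectic_isoperimetric (fun r => coef_a_gt0 r s) (fun r => coef_d_gt0 r s) T0
          (Rlt_le _ _ B0) hB cx cy px py.
rewrite -/(RInt xdy 0 T) -/(hlength A s gam T) /=.
set L := hlength A s gam T; set J := RInt xdy 0 T.
move=> iso.
have L0 : 0 <= L.
  apply: RInt_ge_0; [lra|exact: (ex_RInt_cont _ _ cq)|move=> t _; exact: sqrt_pos].
(* Strictness of the final bound arises here, by integrating a pointwise strict inequality; the
   isoperimetric inequality is weak. *)
have Llt : L < sqrt (coef_c m A s) * sg * RInt et 0 T.
  rewrite -RInt_scale //; apply: RInt_lt => [|t _|t _|t _]; [lra| |exact: cq|exact: qlt].
  by apply: continuous_mul; [exact: continuous_const|exact: cet].
have : sg * RInt et 0 T <= Rabs J.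
  rewrite EI -/J; have := Rle_abs J; have := Rle_abs (- J); rewrite Rabs_Ropp.
  by case: sg1 => ->; lra.
move=> sJ.
have {Llt sJ iso} Llt : L * (4 * PI) < sqrt (coef_c m A s) * Bmax m A s * L ^ 2.
  have h : sqrt (coef_c m A s) * (sg * RInt et 0 T)
      <= sqrt (coef_c m A s) * (Bmax m A s * L ^ 2 / (4 * PI)).
    by apply: Rmult_le_compat_l; lra.
  have : L < sqrt (coef_c m A s) * (Bmax m A s * L ^ 2 / (4 * PI)) by lra.
  move=> /(Rmult_lt_compat_r (4 * PI) _ _ ltac:(lra)).
  have -> : sqrt (coef_c m A s) * (Bmax m A s * L ^ 2 / (4 * PI)) * (4 * PI)
     = sqrt (coef_c m A s) * Bmax m A s * L ^ 2 by field; lra.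
  by [].
rewrite /Lstar; have Bc : 0 < Bmax m A s * sqrt (coef_c m A s) by nra.
apply/Rlt_div_l => //.
(* Zero length would turn [Llt] into 0 < 0, so one factor of L may be cancelled. *)
have Lp : 0 < L by case: (Rle_lt_or_eq_dec _ _ L0) => // e; rewrite -e in Llt; lra.
by nra.
Qed.

Lemma timelike_hlengths_ray s L : s < 0 -> Lstar m A s < L -> exists gam : R -> point m,
  slice_loop (timelike A eps) s gam (2 * PI) /\ hlength A s gam (2 * PI) = L.
Proof.
move=> s0 LL; have [r0 [rho [rho0 er eL]]] := Lstar_radius s0; have pi0 := PI_RGT_0.
have rlt : rho < L / (2 * PI) by apply/Rlt_div_r; lra.
exists (round_loop s (heis1 m) r0 (L / (2 * PI))); split.
  apply: round_loop_slice => u; apply: round_loop_timelike => //; first lra.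
  by rewrite -er; have := coef_c_gt0 s0 => c0; apply: Rmult_lt_compat_l => //; nra.
by rewrite hlength_round_loop; [field|]; lra.
Qed.

Lemma null_loop_Lstar s : s < 0 -> exists gam : R -> point m,
  slice_loop (null A eps) s gam (2 * PI) /\ hlength A s gam (2 * PI) = Lstar m A s.
Proof.
move=> s0; have [r0 [rho [rho0 er ->]]] := Lstar_radius s0.
exists (round_loop s (heis1 m) r0 rho); split; last by apply: hlength_round_loop; lra.
have a0 := coef_a_gt0 r0 s; have d0 := coef_d_gt0 r0 s.
apply: round_loop_slice => u; split; last first.
  by rewrite metric_round_loop // er; field; lra.
move=> e; have := hquad_round_loop s (heis1 m) r0 rho u; rewrite e /hquad big1 => [|r _] /=;
  first nra; ring.
Qed.

(** * Loops on quotients and central circles *)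

Section Quotient.

Variable Gam : heis m -> Prop.
Hypothesis dG : discrete_subgroup Gam.

(** Every lift is a translate of [gam] by one fixed group element, so it inherits the period. *)
Lemma lifts_closed_orbit s (K : point m -> tvec m -> Prop) gam T :
  slice_loop K s gam T -> lifts_closed Gam (fun u => orbit Gam (gam u)) T.
Proof.
move=> [T0 per ss sm]; have smg u := proj1 (sm u).
split=> [|gam2 l2 u]; first by exists gam => u; split.
have [g Gg e] := lifts_differ dG smg (fun u => proj1 (l2 u)) (fun u => proj2 (l2 u)).
by rewrite !e per.
Qed.

Lemma hlength_quot_orbit s (K : point m -> tvec m -> Prop) gam T :
  slice_loop K s gam T ->
  hlength_quot A Gam s (fun u => orbit Gam (gam u)) T (hlength A s gam T).
Proof.
move=> [T0 per ss sm]; have smg u := proj1 (sm u).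
exists (fun u => hspeed A s (velocity gam u)) => [u|].
  by exists gam => //; apply: filter_forall => t.
apply: RInt_correct; apply: ex_RInt_cont => t.
have [_ cx cy _] := smooth_at_C1 smg.
apply: (continuous_comp (fun t => hquad s (velocity gam t)) sqrt); last exact: continuous_sqrt.
apply: continuous_sumR => r; apply: continuous_add;
  apply: continuous_mul; try exact: continuous_const; apply: continuous_sq.
  by have [] := cx r t.
by have [] := cy r t.
Qed.

(** The global closed lift is itself a loop on the cover. The local lifts that witness timelikeness
    and horizontal speed are, near each parameter, translates of it, and both notions are left
    invariant. *)
Lemma closed_lifts_hlength s L : timelike_hlengths_closed_lifts A eps Gam s L ->
  timelike_hlengths m A eps s L.
Proof.
move=> [c [T [[T0 per ss loc] [[gam lg] clos] [f hf If]]]].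
have smg u := proj1 (lg u).
have cmp gam' u : lift_near Gam c gam' u -> exists g, smooth_at gam' u /\
    locally u (fun t => gam t = act g (gam' t)).
  move=> ln; have [sm' _] := locally_singleton _ _ ln.
  have [|g _ lg'] := lifts_differ_locally dG sm' (smg u); last by exists g.
  by apply: filter_imp ln => t [_ <-]; have [_] := lg t.
exists gam, T; split.
  split=> // [u|u|u]; first exact: clos.
    by apply: (ss u); have [_ ->] := lg u; exact: orbit_refl.
  split=> //; have [gam' /cmp [g [sm' lg']] tl] := loc u.
  exact: timelike_act lg' tl.
rewrite -(is_RInt_unique _ _ _ _ If); apply: RInt_extR => u.
have [gam' /cmp [g [sm' lg']] ->] := hf u.
by rewrite /hspeed -!/(hquad _ _) (hquad_act _ sm' lg').
Qed.

(** Commutation with the unit translation along one y_r or x_r, compared in the central coordinate,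
    isolates the conjugate coordinate of [z]. *)
Lemma heis_central_xy (z : heis m) : heis_central z ->
  (forall r, hx z r = 0) /\ (forall r, hy z r = 0).
Proof.
move=> cz; split=> r.
  have := cz (Heis (fun=> 0) (fun i => if i == r then 1 else 0) 0) => /(f_equal (@hw m)) /=.
  rewrite (@sumR_delta _ r) => [|i ir]; last by rewrite (negbTE ir); ring.
  by rewrite eqxx big1 => [|i _]; lra.
have := cz (Heis (fun i => if i == r then 1 else 0) (fun=> 0) 0) => /(f_equal (@hw m)) /=.
rewrite [X in _ = _ + X](@sumR_delta _ r) => [|i ir]; last by rewrite (negbTE ir); ring.
by rewrite eqxx big1 => [|i _]; lra.
Qed.

Definition central_line (k : R) (p : point m) (u : R) : point m :=
  act (Heis (fun=> 0) (fun=> 0) (u * k)) p.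

Lemma central_line_smooth k p u : smooth_at (central_line k p) u.
Proof.
move=> n; split=> [|r|r|] /=.
- by apply: (@trig_smooth _ (pt_s p) 0 0 0 0 0) => t; rewrite /trig; ring.
- by apply: (@trig_smooth _ (hx (pt_h p) r) 0 0 0 0 0) => t; rewrite /trig; ring.
- by apply: (@trig_smooth _ (hy (pt_h p) r) 0 0 0 0 0) => t; rewrite /trig; ring.
- by apply: (@trig_smooth _ (hw (pt_h p)) k 0 0 0 0) => t;
    rewrite /trig big1 => [|r _]; ring.
Qed.

Lemma velocity_central_line k p u :
  velocity (central_line k p) u = TVec 0 (fun=> 0) (fun=> 0) k.
Proof.
rewrite /velocity /=; congr TVec.
- exact: Derive_const.
- by apply: functional_extensionality => r; exact: Derive_const.
- by apply: functional_extensionality => r; exact: Derive_const.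
apply: is_derive_unique.
apply: (@is_derive_extR (fun t => hw (pt_h p) + t * k)) => [t|].
  by rewrite big1 => [|r _]; ring.
by auto_derive => //; ring.
Qed.

Lemma central_circle s (z : heis m) (p : point m) : s < 0 ->
  Gam z -> heis_central z -> z <> heis1 m -> pt_s p = s ->
  let c := fun u => orbit Gam (central_line (hw z) p u) in
  slice_loop_quot (timelike A eps) Gam s c 1 /\ hlength_quot A Gam s c 1 0.
Proof.
move=> s0 Gz /heis_central_xy [zx zy] z1 ps c.
have wz : hw z <> 0 by move=> e; apply: z1; exact: heis_eq.
have lift u : lift_near Gam c (central_line (hw z) p) u.
  by apply: filter_forall => t; split=> //; exact: central_line_smooth.
have hq u : hquad s (velocity (central_line (hw z) p) u) = 0.
  by rewrite velocity_central_line /hquad big1 => [|r _] //=; ring.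
split; last first.
  exists (fun=> 0) => [u|].
    by exists (central_line (hw z) p) => //; rewrite /hspeed -/(hquad _ _) hq sqrt_0.
  by have := @is_RInt_const R_NormedModule 0 1 0; rewrite /scal /= /mult /= Rmult_0_r.
split=> [|u|u q /orbit_pt_s -> //|u]; first lra.
  (* After unit parameter the line has been moved by [z] itself, whose only coordinate is [hw z];
     hence the orbit returns. *)
  rewrite /c -[RHS](orbit_act dG _ Gz); congr (orbit Gam); apply: point_eq => //=.
  apply: heis_eq => [r|r|] /=; rewrite ?zx ?zy; try ring.
  rewrite !big1 => [|r _|r _]; rewrite ?zx; ring.
exists (central_line (hw z) p) => //.
rewrite /timelike metric_slice ?ps //; last by rewrite velocity_central_line.
have := coef_c_gt0 s0; rewrite hq velocity_central_line /eta /= big1 => [|r _]; last ring.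
have := pow2_gt_0 _ wz; rewrite Rminus_0_r => *; nra.
Qed.

Lemma hlength_quot_ge0 s c T L : 0 < T -> hlength_quot A Gam s c T L -> 0 <= L.
Proof.
move=> T0 [f hf If]; apply: (is_RInt_ge_0 _ _ _ _ (Rlt_le _ _ T0) If) => u _.
by have [gam _ ->] := hf u; exact: sqrt_pos.
Qed.

End Quotient.

(** * The limit s -> 0 *)

Lemma Hprod_le : exists2 C, 0 <= C &
  forall s, s ^ 2 <= 1 -> Hprod m A s <= 1 + C * s ^ 2.
Proof.
rewrite /Hprod; elim: (index_enum _) => [|r l [C C0 IH]].
  by exists 0; [lra|move=> s _; rewrite big_nil; lra].
set k := kappa A r ^ 2 / 16.
have k0 : 0 <= k by rewrite /k; have := pow2_ge_0 (kappa A r); lra.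
(* Expanding (1 + k s^2)(1 + C s^2), the cross term in s^4 is absorbed by [s ^ 2 <= 1]. *)
exists (C + k + C * k) => [|s s1]; first by nra.
rewrite big_cons /Fr -/k; have s2 := pow2_ge_0 s.
apply: (Rle_trans _ ((1 + k * s ^ 2) * (1 + C * s ^ 2))).
  by apply: Rmult_le_compat_l (IH s s1); nra.
suff : C * k * (s ^ 2 * s ^ 2) <= C * k * s ^ 2 by nra.
by apply: Rmult_le_compat_l; nra.
Qed.

(** The minimizing index [r2] may vary with s. Comparison with the fixed minimizer [r1] at s = 0
    squeezes the minimum between [P] and [(1 + k * s ^ 2) * P], and sqrt x <= x for x >= 1 controls
    the root of [Hprod]. *)
Lemma Lstar_asymptotics : exists C : R, at_left 0 (fun s => exists2 e : R,
  Rabs e <= C * s ^ 2 &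
  Lstar m A s = 4 * PI / A 0%nat * min_ord (fun r : 'I_m => A_odd A r * A_even A r)
                * (/ sqrt (Rabs s)) * (1 + e)).
Proof.
have [C C0 hC] := Hprod_le.
have [r1 e1 h1] := min_ord_spec (fun r : 'I_m => A_odd A r * A_even A r) hm.
set P := A_odd A r1 * A_even A r1 in e1 h1.
have P0 : 0 < P by apply: Rmult_lt_0_compat; [exact: A_odd_gt0|exact: A_even_gt0].
set k := kappa A r1 ^ 2 / 16.
have k0 : 0 <= k by rewrite /k; have := pow2_ge_0 (kappa A r1); lra.
exists (C + k + C * k); exists (mkposreal 1 Rlt_0_1) => s.
rewrite /ball /= /AbsRing_ball /abs /minus /plus /opp /= => /Rabs_def2 [s1 s2] s0.
have ss1 : s ^ 2 <= 1 by nra.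
have [r2 e2 h2] := min_ord_spec (fun r : 'I_m => Fr A r s * A_odd A r * A_even A r) hm.
set M := Fr A r2 s * A_odd A r2 * A_even A r2 in e2 h2.
have PM : P <= M.
  apply: (Rle_trans _ _ _ (h1 r2)); rewrite /M Rmult_assoc.
  have := Rmult_lt_0_compat _ _ (A_odd_gt0 r2) (A_even_gt0 r2).
  by have := Fr_ge1 r2 s; nra.
have MP : M <= (1 + k * s ^ 2) * P.
  by apply: (Rle_trans _ _ _ (h2 r1)); rewrite /P /Fr -/k; lra.
have H1 := Hprod_ge1 s; have H2 := hC s ss1.
have sH1 : 1 <= sqrt (Hprod m A s) by rewrite -[X in X <= _]sqrt_1; exact: sqrt_le_1_alt.
have sHH : sqrt (Hprod m A s) * sqrt (Hprod m A s) = Hprod m A s by apply: sqrt_def; lra.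
set h := sqrt _ in sH1 sHH.
have hH : h <= 1 + C * s ^ 2 by nra.
have ms : 0 < sqrt (Rabs s) by apply: sqrt_lt_R0; apply: Rabs_pos_lt; lra.
exists (h * M / P - 1); last first.
  by rewrite Lstar_min_ord // e1 e2 -/h; field; lra.
have hM : h * M / P = h * (M / P) by field; lra.
have MP1 : 1 <= M / P by apply/Rle_div_r; lra.
have MP2 : M / P <= 1 + k * s ^ 2 by apply/Rle_div_l; lra.
rewrite Rabs_right hM; last by nra.
have s2' := pow2_ge_0 s.
apply: (Rle_trans _ ((1 + C * s ^ 2) * (1 + k * s ^ 2) - 1)).
  suff : h * (M / P) <= (1 + C * s ^ 2) * (1 + k * s ^ 2) by lra.
  by apply: Rmult_le_compat; lra.
suff : C * k * (s ^ 2 * s ^ 2) <= C * k * s ^ 2 by lra.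
by apply: Rmult_le_compat_l; nra.
Qed.

End Geometry.

Unset Implicit Arguments.

Theorem proposition8p14 (m : nat) (A : nat -> R) (eps : R)
  (hm : (1 <= m)%nat)
  (hA : forall i : nat, (i <= 2 * m)%nat -> 0 < A i)
  (heps : eps = 1 \/ eps = -1) :
  ((forall p : point m, chronology_violating A eps p <-> pt_s p < 0) /\
   (forall p : point m, pt_s p < 0 ->
      exists (gam : R -> point m) (T u : R),
        slice_loop (timelike A eps) (pt_s p) gam T /\ gam u = p) /\
   (forall Gam : heis m -> Prop, discrete_subgroup Gam ->
      (forall p : point m,
         chronology_violating_quot A eps Gam (orbit Gam p) <-> pt_s p < 0) /\
      (forall p : point m, pt_s p < 0 ->
         exists (c : R -> point m -> Prop) (T u : R),
           slice_loop_quot (timelike A eps) Gam (pt_s p) c T /\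
           c u = orbit Gam p)))
  /\
  (forall s : R, s < 0 ->
     Lstar m A s =
       4 * PI * sqrt (Hprod m A s) / (A 0%nat * sqrt (Rabs s))
         * min_ord (fun r : 'I_m => Fr A r s * A_odd A r * A_even A r) /\
     (is_glb_Rbar (timelike_hlengths m A eps s) (Lstar m A s) /\
      (forall L, timelike_hlengths m A eps s L -> Lstar m A s < L) /\
      (forall L, Lstar m A s < L -> timelike_hlengths m A eps s L) /\
      (exists (gam : R -> point m) (T : R), slice_loop (null A eps) s gam T /\
                     hlength A s gam T = Lstar m A s)) /\
     (forall Gam : heis m -> Prop, discrete_subgroup Gam ->
        (is_glb_Rbar (timelike_hlengths_closed_lifts A eps Gam s)
                     (Lstar m A s) /\
         (forall L, timelike_hlengths_closed_lifts A eps Gam s L ->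
                    Lstar m A s < L) /\
         (forall L, Lstar m A s < L ->
                    timelike_hlengths_closed_lifts A eps Gam s L) /\
         (exists (c : R -> point m -> Prop) (T : R), [/\ slice_loop_quot (null A eps) Gam s c T,
                          lifts_closed Gam c T &
                          hlength_quot A Gam s c T (Lstar m A s)])) /\
        (forall z : heis m, Gam z -> heis_central z -> z <> heis1 m ->
           (forall p : point m, pt_s p = s ->
              let c := fun u : R =>
                orbit Gam (act (Heis (fun=> 0) (fun=> 0) (u * hw z)) p) in
              slice_loop_quot (timelike A eps) Gam s c 1 /\
              hlength_quot A Gam s c 1 0) /\
           is_glb_Rbar (timelike_hlengths_quot A eps Gam s) 0)))
  /\
  (exists C : R, at_left 0 (fun s => exists2 e : R,
     Rabs e <= C * s ^ 2 &
     Lstar m A s =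
       4 * PI / A 0%nat * min_ord (fun r : 'I_m => A_odd A r * A_even A r)
         * (/ sqrt (Rabs s)) * (1 + e))).
Proof.
split; [split; [|split]|split].
- move=> p; split; first exact: chronology_violating_lt0.
  exact: chronology_violating_of_lt0.
- move=> p /(timelike_loop_through hm hA heps) [gam [sl g0 _]].
  by exists gam, (2 * PI), 0.
- move=> Gam dG; split=> p.
    split; first exact: chronology_violating_quot_lt0.
    by move=> s0; apply: chronology_violating_orbit; exact: chronology_violating_of_lt0.
  move=> /(timelike_loop_through hm hA heps) [gam [sl g0 _]].
  exists (fun u => orbit Gam (gam u)), (2 * PI), 0; rewrite g0; split=> //.
  exact: slice_loop_orbit.
- move=> s s0; split; first exact: Lstar_min_ord.
  have lower L : timelike_hlengths m A eps s L -> Lstar m A s < L.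
    by move=> [gam [T [sl <-]]]; exact: Lstar_lt_hlength sl.
  have attained L : Lstar m A s < L -> timelike_hlengths m A eps s L.
    move=> /(timelike_hlengths_ray hm hA heps s0) [gam [sl e]].
    by exists gam, (2 * PI).
  have [ngam [nsl ne]] := null_loop_Lstar hm hA heps s0.
  split.
    split; first exact: is_glb_Rbar_open_ray.
    by split=> //; split=> //; exists ngam, (2 * PI).
  move=> Gam dG; split.
    have lowerG L : timelike_hlengths_closed_lifts A eps Gam s L -> Lstar m A s < L.
      by move=> /(closed_lifts_hlength dG) /lower.
    have attainedG L : Lstar m A s < L -> timelike_hlengths_closed_lifts A eps Gam s L.
      move=> /(timelike_hlengths_ray hm hA heps s0) [gam [sl <-]].
      exists (fun u => orbit Gam (gam u)), (2 * PI); split.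
      + exact: slice_loop_orbit.
      + exact: lifts_closed_orbit sl.
      + exact: hlength_quot_orbit sl.
    split; first exact: is_glb_Rbar_open_ray.
    split=> //; split=> //.
    exists (fun u => orbit Gam (ngam u)), (2 * PI); split.
    + exact: slice_loop_orbit.
    + exact: lifts_closed_orbit nsl.
    + by rewrite -ne; exact: hlength_quot_orbit nsl.
  move=> z Gz cz z1.
  have circ (p : point m) (ps : pt_s p = s) := central_circle eps hA dG s0 Gz cz z1 ps.
  split=> //; split=> [L [c [T [[T0 _ _ _] hl]]]|b hb].
    exact: hlength_quot_ge0 hl.
  (* Zero is attained, by the central circle through the identity, so no lower bound exceeds it. *)
  apply: hb; have [h1 h2] := circ (Point s (heis1 m)) erefl.
  by do 2 eexists; split; [exact: h1|exact: h2].
- exact: Lstar_asymptotics.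
Qed.
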